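(* Let $\mathcal A=\mathcal O(\mathrm{SL}_q(2))$ with one of the $4D_\pm$-calculi ($\nu_0=\pm1$), let $\gamma\in\mathbb C$, $\nu\in\{+1,-1\}$, $\eta_i,\eta'_i\in\{+1,-1\}$, and let $D$ be the Dirac operator on $\mathcal S_0$ of the linear left connection $\nabla_{\mathcal S}(\psi)=\theta\otimes_{\mathcal A}\psi-\tau(\psi\otimes_{\mathcal A}\theta)$ with $$\tau(\psi_m^+\otimes\theta_{jk})=\gamma q^{j+k}\hat R^{st}_{lk}(\hat R^{\eta_i})^{rl}_{mj}\,\theta_{rs}\otimes\psi^+_t,\qquad \tau(\psi_m^-\otimes\theta_{jk})=\nu\gamma q^{j+k}(\hat R^{\eta'_i})^{st}_{lk}(\hat R^{-1})^{rl}_{mj}\,\theta_{rs}\otimes\psi^-_t .$$ Then $\mathcal S_0^+=\bigoplus_{m\in\frac12\mathbb N_0}(V_m^+\oplus V_m^-)$ (with $V_0^-=\{0\}$), and $D^2$ acts on these subspaces by scalars: $$D^2{\upharpoonright}V^+_m=-[2]c_1\,\frac{q^{\frac92+2m-\frac32\eta_i}\nu_0^{2m}\gamma-1}{\hat q}\cdot\frac{q^{\frac32-2m-\frac32\eta'_i}\nu_0^{2m}\nu\gamma-1}{\hat q}\,\mathrm{id}\qquad(m\in\tfrac12\mathbb N_0),$$ $$D^2{\upharpoonright}V^-_m=-[2]c_1\,\frac{q^{\frac52-2m-\frac32\eta_i}\nu_0^{2m}\gamma-1}{\hat q}\cdot\frac{q^{\frac72+2m-\frac32\eta'_i}\nu_0^{2m}\nu\gamma-1}{\hat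 q}\,\mathrm{id}\qquad(m\in\tfrac12\mathbb N).$$
   Context: Repeated indices are summed. $q\in\mathbb C\setminus\{0\}$ is not a root of unity, and $q\in\mathbb R$ or $|q|=1$; $q^{1/2}$ is a fixed square root; $\hat q=q-q^{-1}$, $[2]=q+q^{-1}$. Indices run over $1,2$ unless stated otherwise. Put $\check C^{ij}=q^{-1/2}\delta^i_1\delta^j_2-q^{1/2}\delta^i_2\delta^j_1$, $\hat C_{ij}=-\check C^{ij}$, $\hat R^{ij}_{kl}=q^{1/2}\delta^i_k\delta^j_l+q^{-1/2}\check C^{ij}\hat C_{kl}$, with inverse $\hat R^{-1}$. Subscripts $\hat R_{12},\dots$ denote tensor legs. $\mathcal A=\mathcal O(\mathrm{SL}_q(2))$ is the (cosemisimple) Hopf algebra generated by $u^i_j$ with relations $\hat R^{ij}_{kl}u^k_mu^l_n=u^i_ku^j_l\hat R^{kl}_{mn}$, $u^1_1u^2_2-qu^1_2u^2_1=1$, $\varDelta(u^i_j)=u^i_k\otimes u^k_j$, $\varepsilon(u^i_j)=\delta^i_j$. The $4D_\pm$-calculus: $\Gamma$ is the free left $\mathcal A$-module with left-invariant basis $\theta_{ij}$, right multiplication $\theta_{ij}u^k_l=\nu_0\hat R^{mr}_{it}\hat R^{-1}{}^{ts}_{jl}u^k_m\theta_{rs}$ ($\nu_0=+1$ for $4D_+$, $-1$ for $4D_-$), $da=\theta a-a\theta$, $\theta=\frac{q^{1/2}}{\hat q}\check C^{ij}\theta_{ij}$. The braiding is left $\mathcal A$-linear with $\sigma(\theta_{mn}\otimes\theta_{rs})=(\hat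 R_{23}\hat R_{12}\hat R^{-1}_{34}\hat R^{-1}_{23})^{ijkl}_{mnrs}\theta_{ij}\otimes\theta_{kl}$; $g:\Gamma\otimes_{\mathcal A}\Gamma\to\mathcal A$ is left $\mathcal A$-linear with $g(\theta_{ij}\otimes\theta_{kl})=-q^{1/2}c_1\hat C_{im}\hat C_{nl}\hat R^{-1}{}^{mn}_{jk}$, $c_1\in\mathbb R\setminus\{0\}$. $\mathrm{Cl}(\Gamma,\sigma,g)=\Gamma^\otimes/\mathcal I$, $\Gamma^\otimes$ the tensor algebra over $\mathcal A$, $\mathcal I$ the two-sided ideal generated by $\rho_2-g(\rho_2)$ with $\sigma(\rho_2)=\rho_2$. $\mathcal S_0\subset\mathrm{Cl}(\Gamma,\sigma,g)$ is the left ideal (and $\mathcal A$-bimodule) with left $\mathcal A$-basis $\psi^+_1=\frac{q}{[2]c_1}\theta_{11}\theta_{12}\theta_{21}\theta_{22}$, $\psi^+_2=\theta_{21}\theta_{22}$, $\psi^-_1=\theta_{11}\theta_{21}\theta_{22}$, $\psi^-_2=q\theta_{12}\theta_{21}\theta_{22}$; $\mathcal S_0^+=\mathcal A\psi_1^+\oplus\mathcal A\psi_2^+$. $\tau$ is extended left $\mathcal A$-linearly to $\mathcal S_0\otimes_{\mathcal A}\Gamma\to\Gamma\otimes_{\mathcal A}\mathcal S_0$, and $D=\mathrm m\circ\nabla_{\mathcal S}$ with $\mathrm m:\Gamma\otimes_{\mathcal A}\mathcal S_0\to\mathcal S_0$ Clifford multiplication. For $m\in\frac12\mathbb N_0$ let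 $\boldsymbol u^{(m)}=(\boldsymbol u^{(m)}_{rs})$ be the irreducible $(2m+1)$-dimensional corepresentation of $\mathcal A$ ($\boldsymbol u^{(1/2)}=(u^i_j)$). $V_m^{\pm}$ is the linear span of the elements $\sum_{s,i}\boldsymbol u^{(m)}_{rs}\psi^+_iT^{si}_t$ over all $r,t$, where $T=(T^{si}_t)$ is a nonzero intertwiner from $\boldsymbol u^{(m\pm1/2)}$ to $\boldsymbol u^{(m)}\otimes\boldsymbol u^{(1/2)}$ (Clebsch–Gordan matrix, unique up to a scalar). *)

(* Defs.v *)
From HB Require Import structures.
From mathcomp Require Import all_boot all_order all_algebra.
From mathcomp Require Import ring.

Set Implicit Arguments.
Unset Strict Implicit.
Unset Printing Implicit Defensive.

Import Order.TTheory GRing.Theory Num.Theory.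
Local Open Scope ring_scope.

(* The tensor indices 1, 2 are the elements 0, 1 of 'I_2, and a tensor       *)
(* X^{ij}_{kl} is a function X i j k l.  The parameter p is the chosen square *)
(* root of q, so that q = p ^+ 2 and q^(a/2) = p ^ a for an integer a.        *)

Section RMatrix.
Variables (K : fieldType) (p : K).

Definition qhat : K := p ^+ 2 - p ^- 2.
Definition brack2 : K := p ^+ 2 + p ^- 2.

(* Cup i j is check C^{ij} and Cdn i j is hat C_{ij}.                        *)
Definition Cup (i j : 'I_2) : K :=
  p^-1 *+ ((i == 0) && (j == 1)) - p *+ ((i == 1) && (j == 0)).
Definition Cdn (i j : 'I_2) : K := - Cup i j.

Definition tensor4 := 'I_2 -> 'I_2 -> 'I_2 -> 'I_2 -> K.

Definition Rhat : tensor4 := fun i j k l =>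
  p *+ ((i == k) && (j == l)) + p^-1 * Cup i j * Cdn k l.

(* The inverse of Rhat, see RhatK.                                            *)
Definition Rinv : tensor4 := fun i j k l =>
  p^-1 *+ ((i == k) && (j == l)) + p * Cup i j * Cdn k l.

Definition Rpow (eta : int) : tensor4 := if eta == -1 then Rinv else Rhat.

Lemma RhatK (i j k l : 'I_2) : p != 0 ->
  \sum_a \sum_b Rhat i j a b * Rinv a b k l = ((i == k) && (j == l))%:R /\
  \sum_a \sum_b Rinv i j a b * Rhat a b k l = ((i == k) && (j == l))%:R.
Proof.
move=> p0; rewrite !big_ord_recl !big_ord0 /Rhat /Rinv /Cdn /Cup.
case: i => [[|[|//]] ?]; case: j => [[|[|//]] ?];
case: k => [[|[|//]] ?]; case: l => [[|[|//]] ?];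
rewrite /= ?(mulr0n, mulr1n, mul0r, mulr0, addr0, add0r, subr0, sub0r, oppr0);
by rewrite ?(mulfV p0, mulVf p0) //; split; field.
Qed.

(* Operators on four tensor legs, and R acting in two neighbouring legs.      *)
Definition index4 := ('I_2 * 'I_2 * 'I_2 * 'I_2)%type.
Definition op4 := index4 -> index4 -> K.
Definition comp4 (A B : op4) : op4 := fun x z => \sum_y A x y * B y z.

Definition leg12 (X : tensor4) : op4 := fun x y =>
  let: (i, j, k, l) := x in let: (i', j', k', l') := y in
  X i j i' j' *+ ((k == k') && (l == l')).
Definition leg23 (X : tensor4) : op4 := fun x y =>
  let: (i, j, k, l) := x in let: (i', j', k', l') := y in
  X j k j' k' *+ ((i == i') && (l == l')).
Definition leg34 (X : tensor4) : op4 := fun x y =>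
  let: (i, j, k, l) := x in let: (i', j', k', l') := y in
  X k l k' l' *+ ((i == i') && (j == j')).

Definition braid4 : op4 :=
  comp4 (comp4 (comp4 (leg23 Rhat) (leg12 Rhat)) (leg34 Rinv)) (leg23 Rinv).

Definition metric4 (c1 : K) (i j k l : 'I_2) : K :=
  - p * c1 * \sum_m \sum_n Cdn i m * Cdn n l * Rinv m n j k.

End RMatrix.

(* ------------------------------------------------------------------------ *)
Section Algebras.
Variable K : fieldType.

(* The unital subalgebra generated by S is the whole of A.                    *)
Definition generates (A : algType K) (S : A -> Prop) : Prop :=
  forall P : A -> Prop,
    (forall c : K, P c%:A) ->
    (forall x y, P x -> P y -> P (x + y)) ->
    (forall x y, P x -> P y -> P (x * y)) ->
    (forall x, S x -> P x) -> forall x, P x.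

Inductive ideal_gen (A : algType K) (S : A -> Prop) : A -> Prop :=
| ideal_gen_in x : S x -> ideal_gen S x
| ideal_gen0 : ideal_gen S 0
| ideal_genD x y : ideal_gen S x -> ideal_gen S y -> ideal_gen S (x + y)
| ideal_genM a x b : ideal_gen S x -> ideal_gen S (a * x * b).

Definition biadditive (M N G : zmodType) (f : M -> N -> G) : Prop :=
  (forall m m' n, f (m + m') n = f m n + f m' n) /\
  (forall m n n', f m (n + n') = f m n + f m n').

(* T is the tensor product of the algebras A and B over K.                    *)
Record is_tensor_alg (A B T : algType K) (t : A -> B -> T) : Prop := {
  tensA_biadd : biadditive t;
  tensA_bal : forall (c : K) a b, t (c *: a) b = t a (c *: b);
  tensA_scale : forall (c : K) a b, c *: t a b = t (c *: a) b;
  tensA_one : t 1 1 = 1;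
  tensA_mul : forall a a' b b', t a b * t a' b' = t (a * a') (b * b');
  tensA_gen : forall x, exists s : seq (A * B), x = \sum_(y <- s) t y.1 y.2;
  tensA_univ : forall (G : zmodType) (f : A -> B -> G), biadditive f ->
    (forall (c : K) a b, f (c *: a) b = f a (c *: b)) ->
    exists h : {additive T -> G}, forall a b, h (t a b) = f a b
}.

(* Bimodules over the K-algebra A, with K acting centrally.                   *)
Record bimodule (A : algType K) := Bimodule {
  bm_sort :> zmodType;
  lact : A -> bm_sort -> bm_sort;
  ract : bm_sort -> A -> bm_sort;
  lact1 : forall x, lact 1 x = x;
  lactA : forall a b x, lact a (lact b x) = lact (a * b) x;
  lactDl : forall a b x, lact (a + b) x = lact a x + lact b x;
  lactDr : forall a x y, lact a (x + y) = lact a x + lact a y;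
  ract1 : forall x, ract x 1 = x;
  ractA : forall a b x, ract (ract x a) b = ract x (a * b);
  ractDl : forall a x y, ract (x + y) a = ract x a + ract y a;
  ractDr : forall a b x, ract x (a + b) = ract x a + ract x b;
  lractA : forall a b x, lact a (ract x b) = ract (lact a x) b;
  lractC : forall (c : K) x, lact c%:A x = ract x c%:A
}.

End Algebras.

Notation "a *> x" := (lact a x) (at level 40, left associativity) : ring_scope.
Notation "x <* a" := (ract x a) (at level 40, left associativity) : ring_scope.

Section Bimodules.
Variables (K : fieldType) (A : algType K).
Implicit Types M N T : bimodule A.

Definition left_linear M N (f : M -> N) : Prop :=
  forall (a : A) x, f (a *> x) = a *> f x.

Definition left_basis M (I : finType) (e : I -> M) : Prop :=
  forall x, exists! a : {ffun I -> A}, x = \sum_i a i *> e i.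

Definition left_span M (I : finType) (e : I -> M) (x : M) : Prop :=
  exists a : I -> A, x = \sum_i a i *> e i.

Definition lin_span M (I : finType) (e : I -> M) (x : M) : Prop :=
  exists c : I -> K, x = \sum_i (c i)%:A *> e i.

(* T is the tensor product of M and N over A.                                 *)
Record is_tensor M N T (t : M -> N -> T) : Prop := {
  tens_biadd : biadditive t;
  tens_bal : forall m (a : A) n, t (m <* a) n = t m (a *> n);
  tens_lact : forall (a : A) m n, a *> t m n = t (a *> m) n;
  tens_ract : forall (a : A) m n, t m n <* a = t m (n <* a);
  tens_gen : forall x, exists s : seq (M * N), x = \sum_(y <- s) t y.1 y.2;
  tens_univ : forall (G : zmodType) (f : M -> N -> G), biadditive f ->
    (forall m (a : A) n, f (m <* a) n = f m (a *> n)) ->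
    exists h : {additive T -> G}, forall m n, h (t m n) = f m n
}.

Definition bimod_map M (B : algType K)
    (fA : {lrmorphism A -> B}) (fM : {additive M -> B}) : Prop :=
  (forall (a : A) x, fM (a *> x) = fA a * fM x) /\
  (forall (a : A) x, fM (x <* a) = fM x * fA a).

(* TM is the tensor algebra of the A-bimodule M.                              *)
Record is_tensor_algebra M (TM : algType K)
    (jA : {lrmorphism A -> TM}) (jM : {additive M -> TM}) : Prop := {
  talg_bimod : bimod_map jA jM;
  talg_gen : generates
    (fun x => (exists a, x = jA a) \/ (exists m, x = jM m));
  talg_univ : forall (B : algType K)
    (fA : {lrmorphism A -> B}) (fM : {additive M -> B}), bimod_map fA fM ->
    exists h : {lrmorphism TM -> B},
      (forall a, h (jA a) = fA a) /\ (forall m, h (jM m) = fM m)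
}.

End Bimodules.

(* W is the internal direct sum of the subgroups V i.                         *)
Definition is_direct_sum (M : zmodType) (I : eqType)
    (W : M -> Prop) (V : I -> M -> Prop) : Prop :=
  (forall x, W x <-> exists (s : seq I) (y : I -> M),
     [/\ uniq s, forall i, V i (y i) & x = \sum_(i <- s) y i]) /\
  (forall (s : seq I) (y : I -> M), uniq s -> (forall i, V i (y i)) ->
     \sum_(i <- s) y i = 0 -> forall i, i \in s -> y i = 0).

(* ------------------------------------------------------------------------ *)
Section QuantumGroup.
Variables (K : fieldType) (p : K).

Definition SLq2_rel (A : algType K) (u : 'M[A]_2) : Prop :=
  (forall i j m n,
     \sum_k \sum_l Rhat p i j k l *: (u k m * u l n) =
     \sum_k \sum_l Rhat p k l m n *: (u i k * u j l)) /\
  u 0 0 * u 1 1 - p ^+ 2 *: (u 0 1 * u 1 0) = 1.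

(* A is the algebra with generators u i j and relations SLq2_rel.             *)
Record is_SLq2 (A : algType K) (u : 'M[A]_2) : Prop := {
  SLq2_relP : SLq2_rel u;
  SLq2_gen : generates (fun x => exists i j, x = u i j);
  SLq2_univ : forall (B : algType K) (v : 'M[B]_2), SLq2_rel v ->
    exists f : {lrmorphism A -> B}, forall i j, f (u i j) = v i j
}.

(* t : A -> A -> AA presents AA as the tensor square of A over K.             *)
Record is_SLq2_coalg (A : algType K) (u : 'M[A]_2) (AA : algType K)
    (t : A -> A -> AA) (Delta : {lrmorphism A -> AA})
    (eps : {lrmorphism A -> K^o}) : Prop := {
  SLq2_tens : is_tensor_alg t;
  SLq2_Delta : forall i j, Delta (u i j) = \sum_k t (u i k) (u k j);
  SLq2_eps : forall i j, eps (u i j) = (i == j)%:R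
}.

Section Corep.
Variables (A AA : algType K) (t : A -> A -> AA) (Delta : A -> AA) (eps : A -> K).

Definition is_corep n (v : 'M[A]_n) : Prop :=
  (forall r s, Delta (v r s) = \sum_k t (v r k) (v k s)) /\
  (forall r s, eps (v r s) = (r == s)%:R).

Definition intertwines n k (v : 'M[A]_n) (w : 'M[A]_k) (T : 'M[K]_(k, n)) : Prop :=
  w *m map_mx (in_alg A) T = map_mx (in_alg A) T *m v.

(* On K^n, v coacts by e_s |-> \sum_r e_r (x) v r s.  The columns of W span   *)
(* an invariant subspace iff v W = W w for some w; it must be 0 or K^n.       *)
Definition is_irr_corep n (v : 'M[A]_n) : Prop :=
  [/\ is_corep v, (0 < n)%N &
      forall k (W : 'M[K]_(n, k)) (w : 'M[A]_k),
        \rank W = k -> intertwines w v W -> k = 0%N \/ k = n].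

(* T^{si}_t is a nonzero intertwiner from w to the tensor product of v and u. *)
Definition is_CG (u : 'M[A]_2) n k (v : 'M[A]_n) (w : 'M[A]_k)
    (T : 'I_n -> 'I_2 -> 'I_k -> K) : Prop :=
  (exists s i b, T s i b != 0) /\
  (forall r i b, \sum_s \sum_j T s j b *: (v r s * u i j) =
                 \sum_c T r i c *: w c b).

End Corep.

(* ------------------------------------------------------------------------ *)
Section Calculus.
Variables (A : algType K) (u : 'M[A]_2) (Gam : bimodule A).
Variable th : 'I_2 -> 'I_2 -> Gam.

Record is_calculus4D (nu0 : K) : Prop := {
  calc_basis : left_basis (fun x : 'I_2 * 'I_2 => th x.1 x.2);
  calc_ract : forall i j k l, th i j <* u k l =
    \sum_m \sum_r \sum_s \sum_t
      (nu0 * Rhat p m r i t * Rinv p t s j l) *: u k m *> th r s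
}.

Definition theta : Gam :=
  \sum_i \sum_j (p / qhat p * Cup p i j)%:A *> th i j.

Variables (GG : bimodule A) (tGG : Gam -> Gam -> GG).

Record is_braiding (sigma : {additive GG -> GG}) : Prop := {
  braid_lin : left_linear sigma;
  braidE : forall m n r s, sigma (tGG (th m n) (th r s)) =
    \sum_i \sum_j \sum_k \sum_l
      (braid4 p (i, j, k, l) (m, n, r, s))%:A *> tGG (th i j) (th k l)
}.

Record is_metric (c1 : K) (g : {additive GG -> A}) : Prop := {
  metric_lin : forall (a : A) x, g (a *> x) = a * g x;
  metricE : forall i j k l,
    g (tGG (th i j) (th k l)) = (metric4 p c1 i j k l)%:A
}.

(* Cl is the quotient, by pi, of the tensor algebra TG by the ideal generated *)
(* by rho - g rho, for the sigma-invariant elements rho of the second tensor  *)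
(* power of Gam, written as sums of pure tensors.                             *)
Definition clifford_gen (sigma : GG -> GG) (g : GG -> A) (TG : algType K)
    (jA : A -> TG) (jG : Gam -> TG) (x : TG) : Prop :=
  exists s : seq (Gam * Gam),
    let rho := \sum_(y <- s) tGG y.1 y.2 in
    sigma rho = rho /\ x = \sum_(y <- s) jG y.1 * jG y.2 - jA (g rho).

Record is_clifford (sigma : GG -> GG) (g : GG -> A) (TG : algType K)
    (jA : {lrmorphism A -> TG}) (jG : {additive Gam -> TG})
    (Cl : algType K) (pi : {lrmorphism TG -> Cl}) : Prop := {
  cliff_talg : is_tensor_algebra jA jG;
  cliff_surj : forall y, exists x, y = pi x;
  cliff_ker : forall x, pi x = 0 <-> ideal_gen (clifford_gen sigma g jA jG) x
}.

(* Below, iA and iG are the canonical maps of A and Gam to Cl.                *)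
Section Spinors.
Variables (Cl : algType K) (iA : A -> Cl) (iG : Gam -> Cl).

(* S is a copy of the left ideal and sub-bimodule S_0 of Cl, embedded by emb. *)
Record is_S0 (c1 : K) (S : bimodule A) (emb : {additive S -> Cl})
    (psip psim : 'I_2 -> S) : Prop := {
  S0_inj : injective emb;
  S0_lact : forall (a : A) s, emb (a *> s) = iA a * emb s;
  S0_ract : forall (a : A) s, emb (s <* a) = emb s * iA a;
  S0_ideal : forall x s, exists s', emb s' = x * emb s;
  S0_psip1 : emb (psip 0) = (p ^+ 2 / (brack2 p * c1)) *:
    (iG (th 0 0) * iG (th 0 1) * iG (th 1 0) * iG (th 1 1));
  S0_psip2 : emb (psip 1) = iG (th 1 0) * iG (th 1 1);
  S0_psim1 : emb (psim 0) = iG (th 0 0) * iG (th 1 0) * iG (th 1 1);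
  S0_psim2 : emb (psim 1) =
    p ^+ 2 *: (iG (th 0 1) * iG (th 1 0) * iG (th 1 1));
  S0_basis : left_basis
    (fun x : 'I_2 + 'I_2 => match x with inl i => psip i | inr i => psim i end)
}.

Variables (S SG GS : bimodule A) (emb : S -> Cl).
Variables (tSG : S -> Gam -> SG) (tGS : Gam -> S -> GS).
Variables psip psim : 'I_2 -> S.

(* The factor q^{j+k} is for j, k in {1, 2}.                                  *)
Record is_tau (gamma nu : K) (eta eta' : int) (tau : {additive SG -> GS}) :
    Prop := {
  tau_lin : left_linear tau;
  tau_psip : forall m j k, tau (tSG (psip m) (th j k)) =
    \sum_r \sum_s \sum_t \sum_l
      (gamma * (p ^+ 2) ^+ (j.+1 + k.+1)%N *
       Rhat p s t l k * Rpow p eta r l m j)%:A *> tGS (th r s) (psip t);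
  tau_psim : forall m j k, tau (tSG (psim m) (th j k)) =
    \sum_r \sum_s \sum_t \sum_l
      (nu * gamma * (p ^+ 2) ^+ (j.+1 + k.+1)%N *
       Rpow p eta' s t l k * Rinv p r l m j)%:A *> tGS (th r s) (psim t)
}.

Definition nabla (tau : SG -> GS) (x : S) : GS :=
  tGS theta x - tau (tSG x theta).

Definition is_clifford_mul (mul : {additive GS -> S}) : Prop :=
  forall x s, emb (mul (tGS x s)) = iG x * emb s.

Definition dirac (tau : SG -> GS) (mul : GS -> S) (x : S) : S :=
  mul (nabla tau x).

End Spinors.

(* The subspaces V_m^+ and V_m^-, indexed by n = 2m; U n is u^(n/2), and     *)
(* Tp n, Tm n are Clebsch-Gordan matrices for V_{n/2}^+ and V_{(n+1)/2}^-.    *)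
Section Harmonics.
Variables (S : bimodule A) (psip : 'I_2 -> S).
Variable U : forall n, 'M[A]_n.+1.

Definition Vspan n k (T : 'I_n.+1 -> 'I_2 -> 'I_k -> K) (x : S) : Prop :=
  lin_span (fun rb : 'I_n.+1 * 'I_k =>
    \sum_s \sum_i (T s i rb.2 *: U n rb.1 s) *> psip i) x.

Definition Vplus (Tp : forall n, 'I_n.+1 -> 'I_2 -> 'I_n.+2 -> K)
    (n : nat) (x : S) : Prop :=
  Vspan (Tp n) x.

Definition Vminus (Tm : forall n, 'I_n.+2 -> 'I_2 -> 'I_n.+1 -> K)
    (n : nat) (x : S) : Prop :=
  match n with 0%N => x = 0 | n'.+1 => Vspan (Tm n') x end.

End Harmonics.
End Calculus.

(* With n = 2m, q^(9/2 + 2m - 3/2 eta) is p ^ (9 + 2n - 3 eta), and so on.    *)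
Definition eig_plus (nu0 c1 gamma nu : K) (eta eta' : int) (n : nat) : K :=
  - brack2 p * c1
  * ((p ^ (9 + 2 * n%:Z - 3 * eta) * nu0 ^+ n * gamma - 1) / qhat p)
  * ((p ^ (3 - 2 * n%:Z - 3 * eta') * nu0 ^+ n * nu * gamma - 1) / qhat p).

Definition eig_minus (nu0 c1 gamma nu : K) (eta eta' : int) (n : nat) : K :=
  - brack2 p * c1
  * ((p ^ (5 - 2 * n%:Z - 3 * eta) * nu0 ^+ n * gamma - 1) / qhat p)
  * ((p ^ (7 + 2 * n%:Z - 3 * eta') * nu0 ^+ n * nu * gamma - 1) / qhat p).

End QuantumGroup.

(* Main.v *)
Require Import Defs.
From mathcomp Require Import all_boot all_order all_algebra.
From mathcomp Require Import reals complex boolp mxtens ring zify.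

Set Implicit Arguments.
Unset Strict Implicit.
Unset Printing Implicit Defensive.

Import Order.TTheory GRing.Theory Num.Theory.
Local Open Scope ring_scope.

(** The half S_0^+ of the spinors is A (x) C^2, with basis psi^+_i over A, and D
    exchanges it with A psi^-_1 + A psi^-_2.

    Left multiplication by theta is a double braiding.  Moving theta through
    an element a of A and multiplying the resulting theta_{rs} with psi_i gives
    theta a psi^+_i = sum_j X_ij(a) psi^-_j for linear operators X_ij on A.
    The shape of the right multiplication of the calculus, and of the products
    theta_{rs} psi_i, makes X satisfy
      X (a u^k_l psi_i) = nu0 R23^-1 X12 R23^-1 (a u^k_l psi_i)
    (theta_operator); on the psi^-_i the same holds with R in place of R^-1.
    The second term of D comes from the left linear tau, so it is only a
    multiple of a psi^-_i (tau_operator).  On a common eigenvector of both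
    operators X, the operator D^2 is therefore the product of the two factors
    (eigenvalue of X - constant of tau), which is the formula of the theorem
    (eigenvalue_product).

    The products theta_{rs} psi_i themselves come from ten independent
    sigma-invariant tensors; each is a quadratic relation, and together they
    straighten the words in the theta_{ij} (clifford_relations).

    The eigenvalues of X come from R = r + r' cup cap alone, where cup and cap
    are the invariants of u (x) u.  Composing cap with two successive
    Clebsch-Gordan maps gives an intertwiner from u^(n/2 + 1) to u^(n/2), which
    is zero by Schur's lemma.  So R acts as r in the step from V_n^+ to
    V_{n+1}^+, and the eigenvalue of X is multiplied by nu0 r^2 (plus_eig).
    The same argument leads from V_{n+1}^- down to V_n^-, and V_1^- is the image
    of a cup, on which R is again a scalar (minus_eig).

    Directness follows because the eigenvalues of X on all the V_n^+ and V_n^-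
    are distinct: they are powers with distinct exponents of nu0 q^-1, up to a
    common factor, and q is not a root of unity (twist_inj).  The sum is
    everything because u^(n/2) (x) u splits as u^((n+1)/2) + u^((n-1)/2), which
    also shows that the matrix coefficients of the u^(n/2) span A.

    Matrices with entries in the ground field K act on matrices over A through
    the entrywise embedding, written T%:S below. *)

(** * Schur's lemma for corepresentations *)

Section Schur.
Variables (K : fieldType) (A : algType K).
Local Notation "T %:S" := (map_mx (in_alg A) T) (at level 2, format "T %:S").

(** The absence of invariant subspaces, for a bare matrix over A. *)
Definition irreducible n (v : 'M[A]_n) : Prop :=
  forall k (W : 'M[K]_(n, k)) (w : 'M[A]_k),
    \rank W = k -> intertwines w v W -> k = 0%N \/ k = n.

Lemma intertwines_comp n1 n2 n3 (v1 : 'M[A]_n1) (v2 : 'M[A]_n2) (v3 : 'M[A]_n3)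
    f g : intertwines v1 v2 f -> intertwines v2 v3 g ->
  intertwines v1 v3 (g *m f).
Proof.
by rewrite /intertwines map_mxM => Hf Hg; rewrite mulmxA Hg -!mulmxA Hf.
Qed.

Lemma mulmx_map_scalar m n (v : 'M[A]_(m, n)) (c : K) :
  v *m (c%:M)%:S = c%:A *: v.
Proof.
apply/matrixP => i j; rewrite map_scalar_mx !mxE (bigD1 j) //= mxE eqxx.
rewrite big1 => [|k kj]; first by rewrite addr0 mulr1n mulr_algr mulr_algl.
by rewrite mxE (negPf kj) mulr0n mulr0.
Qed.

Lemma mul_map_scalar_mx m n (v : 'M[A]_(m, n)) (c : K) :
  (c%:M)%:S *m v = c%:A *: v.
Proof. by rewrite map_scalar_mx mul_scalar_mx. Qed.

Lemma mulmx_scaleA m n k (v : 'M[A]_(m, n)) (w : 'M[A]_(n, k)) (c : K) :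
  v *m (c%:A *: w) = c%:A *: (v *m w).
Proof. by rewrite -mul_map_scalar_mx mulmxA mulmx_map_scalar -scalemxAl. Qed.

Lemma rank_left_inverse m n (f : 'M[K]_(m, n)) :
  \rank f = n -> exists g : 'M[K]_(n, m), g *m f = 1%:M.
Proof. by move=> /eqP rf; exists (pinvmx f); rewrite mulVpmx. Qed.

(** The kernel of f is the column space of N = 1 - H f, with H a partial inverse
    of f; if it is invariant it is 0 or everything.  Invariance is stated
    without requiring f to intertwine v with anything, so that f may be a
    composite with a projection. *)
Lemma irreducible_ker n k (v : 'M[A]_n) (f : 'M[K]_(k, n)) :
  irreducible v ->
  (forall j (W : 'M[K]_(n, j)), f *m W = 0 -> f%:S *m v *m W%:S = 0) ->
  f != 0 -> \rank f = n.
Proof.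
move=> irr_v ker_inv f0.
pose H := pinvmx f; pose N := 1%:M - H *m f.
have fH : f *m H *m f = f by rewrite mulmxKpV.
have fN : f *m N = 0 by rewrite mulmxBr mulmx1 mulmxA fH subrr.
pose W := col_base N; pose G := row_base N.
have WG : W *m G = N by rewrite mulmx_base.
have [G' GG'] : exists G' , G *m G' = 1%:M.
  by exists (pinvmx G); rewrite mulmxVp ?row_base_free.
have fW : f *m W = 0.
  by rewrite -[LHS]mulmx1 -GG' mulmxA -(mulmxA f) WG fN mul0mx.
have rW : \rank W = \rank N by apply/eqP; exact: col_base_full.
have split1 : 1%:M = W%:S *m G%:S + H%:S *m f%:S :> 'M[A]_n.
  by rewrite -!map_mxM -map_mxD WG subrK map_mx1.
have [] := irr_v _ W (G%:S *m v *m W%:S) rW.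
- rewrite /intertwines -[LHS]mul1mx split1 mulmxDl.
  rewrite -(mulmxA H%:S) (mulmxA f%:S) ker_inv // mulmx0 addr0.
  by rewrite !mulmxA.
- move=> /eqP; rewrite mxrank_eq0 subr_eq0 eq_sym => /eqP Hf.
  by apply/eqP; rewrite -[_ == _]/(row_full f); apply/row_fullP; exists H.
- move=> rN; case/negP: f0; apply/eqP.
  have /row_fullP[N' N'N] : row_full N^T.
    by rewrite /row_full mxrank_tr rN.
  apply: trmx_inj; rewrite -[f^T]mul1mx -N'N -mulmxA -trmx_mul fN.
  by rewrite trmx0 mulmx0.
Qed.

Lemma schur_inj n k (v : 'M[A]_n) (w : 'M[A]_k) f :
  irreducible v -> intertwines v w f -> f != 0 -> \rank f = n.
Proof.
move=> irr_v fP; apply: irreducible_ker irr_v _ => j W fW.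
by rewrite -fP -mulmxA -map_mxM fW map_mx0 mulmx0.
Qed.

Lemma schur_surj n k (v : 'M[A]_n) (w : 'M[A]_k) f :
  irreducible w -> intertwines v w f -> f != 0 -> \rank f = k.
Proof.
move=> irr_w fP f0.
pose W := col_base f; pose G := row_base f.
have WG : W *m G = f by rewrite mulmx_base.
have [G' GG'] : exists G' , G *m G' = 1%:M.
  by exists (pinvmx G); rewrite mulmxVp ?row_base_free.
have fG : f *m G' = W by rewrite -[LHS](congr1 (mulmx^~ G') WG) -mulmxA GG' mulmx1.
have rW : \rank W = \rank f by apply/eqP; exact: col_base_full.
have [] := irr_w _ W (G%:S *m v *m G'%:S) rW; last by [].
- have WS : W%:S = f%:S *m G'%:S by rewrite -map_mxM fG.
  have fS : f%:S = W%:S *m G%:S by rewrite -map_mxM WG.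
  by rewrite /intertwines {1}WS (mulmxA w) fP {1}fS !mulmxA.
- by move=> /eqP; rewrite mxrank_eq0 (negPf f0).
Qed.

Lemma schur_neq n k (v : 'M[A]_n) (w : 'M[A]_k) f :
  irreducible v -> irreducible w -> n != k -> intertwines v w f -> f = 0.
Proof.
move=> irr_v irr_w nk fP; apply/eqP/negPn/negP => f0; case/negP: nk.
by rewrite -(schur_inj irr_v fP f0) (schur_surj irr_w fP f0).
Qed.

(** Complete reducibility by hand: two irreducibles of different dimensions
    mapping to v, whose dimensions add up to that of v, exhaust it.  The left
    inverse L1 is built on the quotient by the image of T2. *)
Lemma intertwines_split n k1 k2 (v : 'M[A]_n) (w1 : 'M[A]_k1) (w2 : 'M[A]_k2)
    T1 T2 :
  irreducible w1 -> irreducible w2 -> k1 != k2 -> n = (k1 + k2)%N ->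
  intertwines w1 v T1 -> intertwines w2 v T2 -> T1 != 0 -> T2 != 0 ->
  exists L1 L2,
  [/\ L1 *m T1 = 1%:M, L1 *m T2 = 0, L2 *m T1 = 0 & L2 *m T2 = 1%:M] /\
  [/\ T1 *m L1 + T2 *m L2 = 1%:M, intertwines v w1 L1 & intertwines v w2 L2].
Proof.
move=> irr1 irr2 neq_k def_n T1P T2P T1n0 T2n0.
have [P PT2] := rank_left_inverse (schur_inj irr2 T2P T2n0).
pose c := 1%:M - T2 *m P.
have cT2 : c *m T2 = 0 by rewrite mulmxBl mul1mx -mulmxA PT2 mulmx1 subrr.
have cT1n0 : c *m T1 != 0.
  apply/eqP; rewrite mulmxBl mul1mx => /eqP; rewrite subr_eq0 => /eqP T1E.
  have : intertwines w1 w2 (P *m T1).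
    have PT2S : P%:S *m T2%:S = 1%:M by rewrite -map_mxM PT2 map_mx1.
    rewrite /intertwines -[LHS]mul1mx -PT2S -mulmxA (mulmxA T2%:S) -T2P.
    by rewrite -(mulmxA v) -map_mxM (mulmxA T2) -T1E T1P mulmxA -map_mxM.
  move/(schur_neq irr1 irr2 neq_k) => PT1; case/eqP: T1n0.
  by rewrite T1E -mulmxA PT1 mulmx0.
have [|J JcT1] := @rank_left_inverse _ _ (c *m T1).
  apply: irreducible_ker irr1 _ cT1n0 => j W cTW.
  have T1W : T1 *m W = T2 *m (P *m T1 *m W).
    apply/eqP; rewrite -subr_eq0 -cTW /c.
    by rewrite !mulmxBl mul1mx !mulmxA.
  rewrite map_mxM -(mulmxA c%:S) -T1P -!mulmxA -map_mxM T1W map_mxM.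
  by rewrite (mulmxA v) T2P !mulmxA -map_mxM cT2 map_mx0 !mul0mx.
pose L1 := J *m c; pose L2 := P *m (1%:M - T1 *m L1).
have L1T1 : L1 *m T1 = 1%:M by rewrite -mulmxA JcT1.
have L1T2 : L1 *m T2 = 0 by rewrite -mulmxA cT2 mulmx0.
have L2T1 : L2 *m T1 = 0.
  by rewrite -mulmxA mulmxBl mul1mx -mulmxA L1T1 mulmx1 subrr mulmx0.
have L2T2 : L2 *m T2 = 1%:M.
  by rewrite -mulmxA mulmxBl mul1mx -mulmxA L1T2 mulmx0 subr0.
exists L1, L2; split; first by split.
have sum1 : T1 *m L1 + T2 *m L2 = 1%:M.
  have : col_mx L1 L2 *m row_mx T1 T2 = 1%:M.
    by rewrite mul_col_row L1T1 L1T2 L2T1 L2T2 -scalar_mx_block.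
  move: (mul_row_col T1 T2 L1 L2) => <-.
  move: (row_mx T1 T2) (col_mx L1 L2); rewrite -def_n => T L.
  exact: mulmx1C.
have vE : v = T1%:S *m w1 *m L1%:S + T2%:S *m w2 *m L2%:S.
  rewrite -T1P -T2P -!mulmxA -!map_mxM -mulmxDr -map_mxD sum1.
  by rewrite map_mx1 mulmx1.
by split; rewrite // /intertwines vE mulmxDr !mulmxA -!map_mxM
  ?L1T1 ?L1T2 ?L2T1 ?L2T2 map_mx0 map_mx1 !mul0mx mul1mx ?addr0 ?add0r.
Qed.
End Schur.

Lemma schur_scalar (K : closedFieldType) (A : algType K) n (v : 'M[A]_n) f :
  (0 < n)%N -> irreducible v -> intertwines v v f -> exists c : K, f = c%:M.
Proof.
move=> n_gt0 irr_v fP.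
have [c rc] : exists c, root (char_poly f) c.
  by apply/closed_rootP; rewrite size_char_poly; case: n n_gt0 {v f irr_v fP}.
exists c; apply/eqP; rewrite -subr_eq0; apply/negPn/negP => fc0.
have fcP : intertwines v v (f - c%:M).
  rewrite /intertwines map_mxB mulmxBl mulmxBr fP.
  by rewrite mulmx_map_scalar mul_map_scalar_mx.
move: rc; rewrite -eigenvalue_root_char /eigenvalue /eigenspace kermx_eq0.
by rewrite /row_free (schur_inj irr_v fcP fc0) eqxx.
Qed.

(** * Tensoring with the fundamental corepresentation *)

Section Tensor2.
Variables (K : fieldType) (A : algType K).
Local Notation "T %:S" := (map_mx (in_alg A) T) (at level 2, format "T %:S").
Local Notation pr i j := (mxtens_index (i, j)).

Definition tens1 (B : pzRingType) m n (f : 'M[B]_(m, n)) : 'M[B]_(m * 2, n * 2) :=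
  f *t 1%:M.

Lemma tens_index_eq m n (i k : 'I_m) (j l : 'I_n) :
  (pr i j == pr k l) = (i == k) && (j == l).
Proof. exact: (can_eq (@mxtens_indexK m n) (i, j) (k, l)). Qed.

Lemma big_tens (V : zmodType) m n (F : 'I_(m * n) -> V) :
  \sum_x F x = \sum_i \sum_j F (pr i j).
Proof.
rewrite pair_big /=; apply: reindex => /=.
exists (@mxtens_unindex m n) => x _; last by rewrite mxtens_unindexK.
by rewrite mxtens_indexK; case: x.
Qed.

Lemma matrix_tensP (B : Type) m1 m2 n1 n2 (f g : 'M[B]_(m1 * m2, n1 * n2)) :
  (forall i k j l, f (pr i k) (pr j l) = g (pr i k) (pr j l)) -> f = g.
Proof.
move=> fg; apply/matrixP => x y.
by case: (mxtens_indexP x) => i k; case: (mxtens_indexP y) => j l.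
Qed.

Lemma matrix_ltensP (B : Type) m1 m2 n (f g : 'M[B]_(m1 * m2, n)) :
  (forall i k j, f (pr i k) j = g (pr i k) j) -> f = g.
Proof.
by move=> fg; apply/matrixP => x y; case: (mxtens_indexP x) => i k.
Qed.

Lemma matrix_rtensP (B : Type) m n1 n2 (f g : 'M[B]_(m, n1 * n2)) :
  (forall i j l, f i (pr j l) = g i (pr j l)) -> f = g.
Proof.
by move=> fg; apply/matrixP => x y; case: (mxtens_indexP y) => i k.
Qed.

Lemma tens1E (B : pzRingType) m n (f : 'M[B]_(m, n)) i k j l :
  tens1 f (pr i k) (pr j l) = f i j *+ (k == l).
Proof. by rewrite /tens1 tensmxE mxE mulr_natr. Qed.

Lemma mul_tens1E (B : pzRingType) m n k (f : 'M[B]_(m, n)) (g : 'M[B]_(n * 2, k))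
    i j x :
  (tens1 f *m g) (pr i j) x = \sum_s f i s * g (pr s j) x.
Proof.
rewrite mxE big_tens; apply: eq_bigr => s _.
rewrite (bigD1 j) //= big1 ?addr0 => [|l lj].
  by rewrite tens1E eqxx.
by rewrite tens1E eq_sym (negPf lj) mul0r.
Qed.

Lemma mul_mx_tens1E (B : pzRingType) m n k (f : 'M[B]_(m, n)) (g : 'M[B]_(k, m * 2))
    i j x :
  (g *m tens1 f) x (pr i j) = \sum_s g x (pr s j) * f s i.
Proof.
rewrite mxE big_tens; apply: eq_bigr => s _.
rewrite (bigD1 j) //= big1 ?addr0 => [|l lj].
  by rewrite tens1E eqxx.
by rewrite tens1E (negPf lj) mulr0.
Qed.

Lemma tens1M (B : pzRingType) m n k (f : 'M[B]_(m, n)) (g : 'M[B]_(n, k)) :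
  tens1 (f *m g) = tens1 f *m tens1 g.
Proof.
apply: matrix_tensP => i a j b; rewrite mul_tens1E tens1E mxE -sumrMnl.
by apply: eq_bigr => s _; rewrite tens1E mulrnAr.
Qed.

Lemma tens1_1 (B : pzRingType) n : tens1 (1%:M : 'M[B]_n) = 1%:M.
Proof.
apply: matrix_tensP => i a j b; rewrite tens1E !mxE.
rewrite tens_index_eq.
by rewrite -mulrnA mulnb.
Qed.

Lemma tens1S m n (f : 'M[K]_(m, n)) : tens1 f%:S = (tens1 f)%:S.
Proof. by rewrite /tens1 map_mxT map_mx1. Qed.

Lemma tens1Z (B : pzRingType) m n (c : B) (f : 'M[B]_(m, n)) :
  tens1 (c *: f) = c *: tens1 f.
Proof.
apply: matrix_tensP => i a j b.
by rewrite tens1E [RHS]mxE tens1E mxE mulrnAr.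
Qed.

Lemma tens1_scalar (B : pzRingType) n (c : B) :
  tens1 (c%:M : 'M[B]_n) = c%:M.
Proof. by rewrite -scalemx1 tens1Z tens1_1 scalemx1. Qed.

Variable u : 'M[A]_2.

Lemma tensmx_tens1 m n (v : 'M[A]_(m, n)) : v *t u = tens1 v *m (1%:M *t u).
Proof.
apply: matrix_tensP => i a j b; rewrite tensmxE mul_tens1E.
rewrite (bigD1 j) //= big1 ?addr0 => [|s sj].
  by rewrite tensmxE mxE eqxx mul1r.
by rewrite tensmxE mxE (negPf sj) mul0r mulr0.
Qed.

Lemma tensmx_tens1S m n k (v : 'M[A]_(m, n)) (f : 'M[K]_(n, k)) :
  (v *m f%:S) *t u = v *t u *m tens1 f%:S.
Proof.
apply: matrix_tensP => i a j b; rewrite tensmxE mul_mx_tens1E mxE mulr_suml.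
apply: eq_bigr => s _; rewrite tensmxE mxE.
by rewrite !mulr_algr scalerAl.
Qed.

Lemma tens1S_tensmx m n k (v : 'M[A]_(m, n)) (f : 'M[K]_(k, m)) :
  (f%:S *m v) *t u = tens1 f%:S *m (v *t u).
Proof. by rewrite (tensmx_tens1 (_ *m _)) tens1M -mulmxA -tensmx_tens1. Qed.

Lemma intertwines_tens m n (v : 'M[A]_m) (w : 'M[A]_n) f :
  intertwines v w f -> intertwines (v *t u) (w *t u) (tens1 f).
Proof.
by rewrite /intertwines -tens1S -tensmx_tens1S => ->; rewrite tens1S_tensmx.
Qed.

(** The tensors C and D stand for an invariant vector and an invariant form of
    u (x) u; cup and cap insert and contract them in the last two legs. *)
Variables C D : 'I_2 -> 'I_2 -> K.

Definition cup n : 'M[K]_(n * 2 * 2, n) :=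
  \matrix_(x, s) let y := mxtens_unindex x in
    C (mxtens_unindex y.1).2 y.2 *+ ((mxtens_unindex y.1).1 == s).
Definition cap n : 'M[K]_(n, n * 2 * 2) :=
  \matrix_(s, x) let y := mxtens_unindex x in
    D (mxtens_unindex y.1).2 y.2 *+ (s == (mxtens_unindex y.1).1).

Lemma cupE n (s s' : 'I_n) i j : cup n (pr (pr s i) j) s' = C i j *+ (s == s').
Proof. by rewrite mxE mxtens_indexK /fst /snd mxtens_indexK. Qed.

Lemma capE n (s s' : 'I_n) i j : cap n s (pr (pr s' i) j) = D i j *+ (s == s').
Proof. by rewrite mxE mxtens_indexK /fst /snd mxtens_indexK. Qed.

Hypothesis u_cup : forall i j,
  \sum_k \sum_l C k l *: (u i k * u j l) = (C i j)%:A.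
Hypothesis u_cap : forall i j,
  \sum_k \sum_l D k l *: (u k i * u l j) = (D i j)%:A.

Lemma cup_intertwines n (v : 'M[A]_n) : intertwines v (v *t u *t u) (cup n).
Proof.
apply: matrix_ltensP => x j t; case: (mxtens_indexP x) => s i.
transitivity (v s t * (C i j)%:A).
  rewrite -u_cup mxE !big_tens mulr_sumr (bigD1 t) //= [X in _ + X]big1 ?addr0.
    apply: eq_bigr => k _; rewrite mulr_sumr; apply: eq_bigr => l _.
    rewrite !tensmxE mxE cupE eqxx mulr1n mulr_algr.
    by rewrite -scalerAr mulrA.
  move=> s' s't; rewrite big1 // => k _; rewrite big1 // => l _.
  by rewrite [X in _ * X]mxE cupE (negPf s't) mulr0n rmorph0 mulr0.
rewrite mxE (bigD1 s) //= big1 ?addr0 => [|s' s's].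
  by rewrite mxE cupE eqxx mulr_algl mulr_algr.
by rewrite mxE cupE eq_sym (negPf s's) mulr0n rmorph0 mul0r.
Qed.

Lemma cap_intertwines n (v : 'M[A]_n) : intertwines (v *t u *t u) v (cap n).
Proof.
apply/esym; apply: matrix_rtensP => t x j; case: (mxtens_indexP x) => s i.
transitivity (v t s * (D i j)%:A).
  rewrite -u_cap mxE !big_tens mulr_sumr (bigD1 t) //= [X in _ + X]big1 ?addr0.
    apply: eq_bigr => k _; rewrite mulr_sumr; apply: eq_bigr => l _.
    rewrite !tensmxE mxE capE eqxx mulr1n mulr_algl.
    by rewrite -scalerAr mulrA.
  move=> s' s't; rewrite big1 // => k _; rewrite big1 // => l _.
  by rewrite [X in X * _]mxE capE eq_sym (negPf s't) mulr0n rmorph0 mul0r.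
rewrite mxE (bigD1 s) //= big1 ?addr0 => [|s' s's].
  by rewrite mxE capE eqxx mulr_algr.
by rewrite mxE capE (negPf s's) mulr0n rmorph0 mulr0.
Qed.

Lemma cap_cup n : cap n *m cup n = (\sum_i \sum_j D i j * C i j)%:M.
Proof.
apply/matrixP => s t; rewrite !mxE !big_tens (bigD1 s) //= [X in _ + X]big1.
  rewrite addr0 -sumrMnl; apply: eq_bigr => i _; rewrite -sumrMnl.
  by apply: eq_bigr => j _; rewrite capE cupE eqxx mulr1n mulrnAr.
move=> s' s's; rewrite big1 // => i _; rewrite big1 // => j _.
by rewrite capE eq_sym (negPf s's) mul0r.
Qed.

Variables r r' : K.

(** Rhat and its inverse are both of this form, with r and r' exchanged. *)
Definition Rgen (i j k l : 'I_2) : K :=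
  r *+ ((i == k) && (j == l)) + r' * C i j * D k l.

Definition R23 n : 'M[K]_(n * 2 * 2) := r%:M + r' *: (cup n *m cap n).

Lemma R23E n (s t : 'I_n) i j k l :
  R23 n (pr (pr s i) j) (pr (pr t k) l) = Rgen i j k l *+ (s == t).
Proof.
rewrite !mxE (bigD1 t) //= big1 ?addr0 => [|t' t't]; last first.
  by rewrite capE (negPf t't) mulr0.
rewrite !tens_index_eq cupE capE eqxx mulr1n /Rgen.
by case: (s == t); rewrite ?mulr1n ?mulr0n ?mul0r ?mulr0 ?addr0 ?mulrA.
Qed.

Lemma mul_R23E n m (M : 'M[K]_(n * 2 * 2, m)) (s : 'I_n) i j y :
  (R23 n *m M) (pr (pr s i) j) y =
  \sum_k \sum_l Rgen i j k l * M (pr (pr s k) l) y.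
Proof.
rewrite mxE !big_tens (bigD1 s) //= [X in _ + X]big1 ?addr0 => [|t ts].
  by apply: eq_bigr => k _; apply: eq_bigr => l _; rewrite R23E eqxx.
rewrite big1 // => k _; rewrite big1 // => l _.
by rewrite R23E eq_sym (negPf ts) mul0r.
Qed.

Lemma R23_intertwines n (v : 'M[A]_n) :
  intertwines (v *t u *t u) (v *t u *t u) (R23 n).
Proof.
have := intertwines_comp (cap_intertwines v) (cup_intertwines v).
rewrite /intertwines /R23 map_mxD map_mxZ mulmxDr mulmxDl => cc.
rewrite mulmx_map_scalar mul_map_scalar_mx; congr (_ + _).
by rewrite -scalemxAl -cc -mulmx_scaleA.
Qed.

(** R acts as the scalar r wherever the last two legs have no trivial part. *)
Lemma R23_cap0 n m (M : 'M[K]_(n * 2 * 2, m)) :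
  cap n *m M = 0 -> R23 n *m M = r *: M.
Proof.
move=> cM; rewrite mulmxDl mul_scalar_mx -scalemxAl -mulmxA cM mulmx0.
by rewrite scaler0 addr0.
Qed.

Lemma R23_cup n :
  R23 n *m cup n = (r + r' * \sum_i \sum_j D i j * C i j) *: cup n.
Proof.
rewrite mulmxDl mul_scalar_mx -scalemxAl -mulmxA cap_cup mul_mx_scalar.
by rewrite scalerA scalerDl.
Qed.

(** X is an operator on A (x) K^2, sending a e_i to sum_j X_ij(a) e_j.  Its
    recursion along a |-> a u^k_l is conjugation by R in the last two legs. *)
Variable X : 'I_2 -> 'I_2 -> A -> A.
Hypothesis XL : forall i j (c : K) a b, X i j (c *: a + b) = c *: X i j a + X i j b.
Variables (nu x0 : K).
Hypothesis X1 : forall i j, X i j 1 = (x0 *+ (i == j))%:A.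
Hypothesis XM : forall i j a k l, X i j (a * u k l) =
  nu *: \sum_c \sum_d \sum_b \sum_e (Rgen c j d b * Rgen e b l i) *: (X e d a * u k c).

Lemma X0 i j : X i j 0 = 0.
Proof. by have := XL i j (-1) 0 0; rewrite scaler0 addr0 scaleN1r addNr. Qed.
Lemma XD i j a b : X i j (a + b) = X i j a + X i j b.
Proof. by have := XL i j 1 a b; rewrite !scale1r. Qed.
Lemma XZ i j c a : X i j (c *: a) = c *: X i j a.
Proof. by have := XL i j c a 0; rewrite X0 !addr0. Qed.
Lemma Xsum i j I (s : seq I) (P : pred I) F :
  X i j (\sum_(k <- s | P k) F k) = \sum_(k <- s | P k) X i j (F k).
Proof. by apply: (big_morph _ (XD i j) (X0 i j)). Qed.

(** The action of X on the first leg of v (x) 1, as one matrix: X acts on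
    the span of the entries of v by B when Xmx v = (v (x) 1) B. *)
Definition Xmx m n (v : 'M[A]_(m, n)) : 'M[A]_(m * 2, n * 2) :=
  \matrix_(x, y) X (mxtens_unindex y).2 (mxtens_unindex x).2
     (v (mxtens_unindex x).1 (mxtens_unindex y).1).

Lemma XmxE m n (v : 'M[A]_(m, n)) a i b j : Xmx v (pr a i) (pr b j) = X j i (v a b).
Proof. by rewrite mxE mxtens_indexK /fst /snd mxtens_indexK. Qed.

Lemma Xmx1 n : Xmx (1%:M : 'M[A]_n) = (x0%:M)%:S.
Proof.
apply: matrix_tensP => a i b j; rewrite XmxE !mxE.
rewrite tens_index_eq.
by case: (a == b); rewrite ?mulr1n ?X1 ?mulr0n ?X0 ?rmorph0 //= eq_sym.
Qed.

Lemma Xmx_mulr m n k (v : 'M[A]_(m, n)) (f : 'M[K]_(n, k)) :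
  Xmx (v *m f%:S) = Xmx v *m (tens1 f)%:S.
Proof.
apply: matrix_tensP => a i b j; rewrite -tens1S XmxE mul_mx_tens1E mxE Xsum.
by apply: eq_bigr => s _; rewrite XmxE mxE !mulr_algr XZ.
Qed.

Lemma Xmx_mull m n k (v : 'M[A]_(m, n)) (f : 'M[K]_(k, m)) :
  Xmx (f%:S *m v) = (tens1 f)%:S *m Xmx v.
Proof.
apply: matrix_tensP => a i b j; rewrite -tens1S XmxE mul_tens1E mxE Xsum.
by apply: eq_bigr => s _; rewrite XmxE mxE !mulr_algl XZ.
Qed.

Lemma R23_conjE n (B : 'M[K]_(n * 2)) (s t : 'I_n) c j l i :
  (R23 n *m tens1 B *m R23 n) (pr (pr t c) j) (pr (pr s l) i) =
  \sum_d \sum_b \sum_e Rgen c j d b * Rgen e b l i * B (pr t d) (pr s e).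
Proof.
rewrite -mulmxA mul_R23E; apply: eq_bigr => d _; apply: eq_bigr => b _.
rewrite mul_tens1E big_tens (bigD1 s) //= [X in _ + X]big1 => [|s' s's].
  rewrite addr0 mulr_sumr; apply: eq_bigr => e _.
  by rewrite R23E eqxx mulr1n mulrCA mulrC.
by apply: big1 => e _; rewrite R23E (negPf s's) mulr0.
Qed.

Lemma Xmx_tens m n (v : 'M[A]_(m, n)) B : Xmx v = tens1 v *m B%:S ->
  Xmx (v *t u) = tens1 (v *t u) *m (nu *: (R23 n *m tens1 B *m R23 n))%:S.
Proof.
move=> vB; apply: matrix_tensP => x j y i.
case: (mxtens_indexP x) => a k; case: (mxtens_indexP y) => s l.
rewrite XmxE tensmxE XM mul_tens1E big_tens [RHS]exchange_big /= scaler_sumr.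
apply: eq_bigr => c _.
have XE d e : X e d (v a s) = \sum_t B (pr t d) (pr s e) *: v a t.
  by rewrite -XmxE vB mul_tens1E; apply: eq_bigr => t _; rewrite mxE mulr_algr.
under eq_bigr => d _ do under eq_bigr => b _ do under eq_bigr => e _ do
  rewrite XE mulr_suml scaler_sumr.
under eq_bigr => d _ do under eq_bigr => b _ do rewrite exchange_big.
under eq_bigr => d _ do rewrite exchange_big.
rewrite exchange_big scaler_sumr; apply: eq_bigr => t _ /=.
rewrite tensmxE mxE mxE mulr_algr -scalerA; congr (_ *: _).
rewrite R23_conjE scaler_suml; apply: eq_bigr => d _.
rewrite scaler_suml; apply: eq_bigr => b _.
rewrite scaler_suml; apply: eq_bigr => e _.
by rewrite -scalerAl scalerA.
Qed.

(** If X acts on the entries of v by an intertwiner B, it acts on those of any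
    direct summand w of v (x) u by the compression of nu R23 B12 R23. *)
Lemma Xmx_compress n k (v : 'M[A]_n) (w : 'M[A]_k) B (T : 'M[K]_(n * 2, k)) L :
  Xmx v = tens1 v *m B%:S -> intertwines (v *t u) (v *t u) B ->
  intertwines w (v *t u) T -> intertwines (v *t u) w L -> L *m T = 1%:M ->
  let B' := nu *: (tens1 L *m (R23 n *m tens1 B *m R23 n) *m tens1 T) in
  Xmx w = tens1 w *m B'%:S /\ intertwines (w *t u) (w *t u) B'.
Proof.
move=> vB BP TP LP LT B'.
have LTS : L%:S *m T%:S = 1%:M by rewrite -map_mxM LT map_mx1.
have wE : w = L%:S *m (v *t u) *m T%:S by rewrite -mulmxA TP mulmxA LTS mul1mx.
have B'E : B' = tens1 L *m (nu *: (R23 n *m tens1 B *m R23 n)) *m tens1 T.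
  by rewrite /B' -scalemxAr -scalemxAl.
split.
  rewrite {1}wE Xmx_mulr Xmx_mull (Xmx_tens vB) B'E !map_mxM !mulmxA.
  congr (_ *m _ *m _); rewrite -!tens1S -!tens1M.
  by rewrite -LP.
have RP := R23_intertwines v.
have BBP := intertwines_tens BP.
have := intertwines_comp (intertwines_comp RP BBP) RP.
move/(intertwines_comp (intertwines_tens TP)).
move/intertwines_comp => /(_ _ _ _ (intertwines_tens LP)).
rewrite /intertwines /B' map_mxZ /= !mulmxA => BP'.
by rewrite mulmx_scaleA BP' scalemxAl.
Qed.

(** On T' the last two legs contain no trivial part, so both factors R23 act as
    r, and the eigenvalue x of B on the image of T becomes nu r^2 x. *)
Lemma compress_eig n k k' B (T : 'M[K]_(n * 2, k)) L
    (T' : 'M[K]_(k * 2, k')) x :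
  B *m T = x *: T -> L *m T = 1%:M -> cap n *m tens1 T *m T' = 0 ->
  nu *: (tens1 L *m (R23 n *m tens1 B *m R23 n) *m tens1 T) *m T' =
  (nu * r ^+ 2 * x) *: T'.
Proof.
move=> BT LT cT.
have RT : R23 n *m (tens1 T *m T') = r *: (tens1 T *m T').
  by apply: R23_cap0; rewrite mulmxA.
have BTT : tens1 B *m (tens1 T *m T') = x *: (tens1 T *m T').
  by rewrite mulmxA -tens1M BT tens1Z scalemxAl.
rewrite -scalemxAl -!mulmxA RT -scalemxAr BTT -!scalemxAr RT.
rewrite -!scalemxAr mulmxA -tens1M LT tens1_1 mul1mx !scalerA.
by congr (_ *: _); ring.
Qed.
End Tensor2.

(** * Eigenvalues of the double braiding on the harmonics *)

Section Harmonic.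
Variables (K : closedFieldType) (A : algType K) (u : 'M[A]_2).
Local Notation "T %:S" := (map_mx (in_alg A) T) (at level 2, format "T %:S").
Local Notation pr i j := (mxtens_index (i, j)).

Variables C D : 'I_2 -> 'I_2 -> K.
Hypothesis u_cup : forall i j,
  \sum_k \sum_l C k l *: (u i k * u j l) = (C i j)%:A.
Hypothesis u_cap : forall i j,
  \sum_k \sum_l D k l *: (u k i * u l j) = (D i j)%:A.
Local Notation delta := (\sum_i \sum_j D i j * C i j).
Hypothesis delta0 : delta != 0.

Variable U : forall n, 'M[A]_n.+1.
Variable TP : forall n, 'M[K]_(n.+1 * 2, n.+2).
Variable TM : forall n, 'M[K]_(n.+2 * 2, n.+1).
Hypothesis U_irr : forall n, irreducible (U n).
Hypothesis U1 : U 1 = u.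
Hypothesis TPP : forall n, intertwines (U n.+1) (U n *t u) (TP n).
Hypothesis TMP : forall n, intertwines (U n) (U n.+1 *t u) (TM n).
Hypothesis TP0 : forall n, TP n != 0.
Hypothesis TM0 : forall n, TM n != 0.

Lemma U_split n : exists L1 L2,
  [/\ L1 *m TP n.+1 = 1%:M, L1 *m TM n = 0, L2 *m TP n.+1 = 0 & L2 *m TM n = 1%:M] /\
  [/\ TP n.+1 *m L1 + TM n *m L2 = 1%:M,
      intertwines (U n.+1 *t u) (U n.+2) L1 & intertwines (U n.+1 *t u) (U n) L2].
Proof.
have neq : n.+3 != n.+1 by clear -n; lia.
have dim : (n.+2 * 2 = n.+3 + n.+1)%N by clear -n; lia.
exact: (intertwines_split (@U_irr n.+2) (@U_irr n) neq dim (TPP n.+1) (TMP n)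
         (TP0 n.+1) (TM0 n)).
Qed.

(** The tensor product of U 0 with u has only one summand. *)
Lemma U_split0 : exists L, [/\ L *m TP 0 = 1%:M, TP 0 *m L = 1%:M &
   intertwines (U 0 *t u) (U 1) L].
Proof.
have [L LT] := rank_left_inverse (schur_inj (@U_irr 1) (TPP 0) (TP0 0)).
have TL : TP 0 *m L = 1%:M by apply: mulmx1C.
exists L; split=> //.
have LTS : L%:S *m (TP 0)%:S = 1%:M by rewrite -map_mxM LT map_mx1.
have TLS : (TP 0)%:S *m L%:S = 1%:M by rewrite -map_mxM TL map_mx1.
rewrite /intertwines -[RHS]mulmx1 -TLS mulmxA -(mulmxA L%:S) TPP.
by rewrite mulmxA LTS mul1mx.
Qed.

(** A one-dimensional corepresentation need not be trivial a priori.  The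
    invariant vector c of u (x) u has no component in the three-dimensional
    U 2, so it spans the other summand U 0. *)
Lemma U0_eq1 : U 0 = 1%:M.
Proof.
pose c : 'M[K]_(2 * 2, 1) :=
  \matrix_(x, y) C (mxtens_unindex x).1 (mxtens_unindex x).2.
have cE i j y : c (pr i j) y = C i j by rewrite mxE mxtens_indexK.
have cP : intertwines (1%:M : 'M[A]_1) (u *t u) c.
  apply: matrix_ltensP => i j y; rewrite mulmx1 [RHS]mxE cE /= -u_cup mxE big_tens.
  apply: eq_bigr => k _; apply: eq_bigr => l _.
  by rewrite tensmxE mxE cE mulr_algr.
have c0 : c != 0.
  apply: contra_neq delta0 => c0; rewrite big1 // => i _; rewrite big1 // => j _.
  by rewrite -(cE i j ord0) c0 mxE mulr0.
have irr1 : irreducible (1%:M : 'M[A]_1).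
  move=> k W w rW _; have := rank_leq_row W; rewrite rW.
  by case: k {W w rW} => [|[|k]] //; [left | right].
have [L1 [L2 []]] := U_split 0; rewrite U1 => _ [TL L1P L2P].
have L1c : L1 *m c = 0.
  exact: (schur_neq irr1 (@U_irr 2) _ (intertwines_comp cP L1P)).
have L2c : L2 *m c != 0.
  apply: contra_neq c0 => L2c.
  by rewrite -[c]mul1mx -TL mulmxDl -!mulmxA L1c L2c !mulmx0 addr0.
have := intertwines_comp cP L2P; rewrite /intertwines mulmx1.
move: L2c; rewrite [L2 *m c]mx11_scalar; set m := _ 0 0 => m0.
rewrite mulmx_map_scalar map_scalar_mx => e.
have {}m0 : m != 0 by apply: contra_neq m0 => ->; rewrite raddf0.
have mV : (m^-1)%:A * m%:A = 1 :> A by rewrite mulr_algl scalerA mulVf // scale1r.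
rewrite -[LHS]scale1r -mV -scalerA e scale_scalar_mx mV //.
Qed.

Section Eig.
Variables (r r' : K).
Variable X : 'I_2 -> 'I_2 -> A -> A.
Hypothesis XL : forall i j (c : K) a b, X i j (c *: a + b) = c *: X i j a + X i j b.
Variables (nu x0 : K).
Hypothesis X1 : forall i j, X i j 1 = (x0 *+ (i == j))%:A.
Hypothesis XM : forall i j a k l, X i j (a * u k l) =
  nu *: \sum_c \sum_d \sum_b \sum_e
   (Rgen C D r r' c j d b * Rgen C D r r' e b l i) *: (X e d a * u k c).
Hypotheses (nu0 : nu != 0) (r0 : r != 0).
Variable eps : A -> K.
Hypothesis epsL : forall (c : K) a b, eps (c *: a + b) = c * eps a + eps b.
Hypothesis epsU : forall n i j, eps (U n i j) = (i == j)%:R.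

Local Notation rho := (r + r' * delta).

(** By induction, U n.+1 being a summand of U n (x) u: the composite
    cap (T (x) 1) T' goes from U n.+2 to U n, hence vanishes. *)
Lemma Xmx_harmonic n : exists B, [/\ Xmx X (U n) = tens1 (U n) *m B%:S,
  intertwines (U n *t u) (U n *t u) B &
  B *m TP n = ((nu * r ^+ 2) ^+ n * x0) *: TP n].
Proof.
elim: n => [|n [B [UB BP BT]]].
  exists x0%:M; split.
  - by rewrite U0_eq1 (Xmx1 XL X1) tens1_1 mul1mx.
  - by rewrite /intertwines mulmx_map_scalar mul_map_scalar_mx.
  - by rewrite expr0 mul1r mul_scalar_mx.
have [L [LT LP]] : exists L, L *m TP n = 1%:M /\ intertwines (U n *t u) (U n.+1) L.
  case: n {B UB BP BT} => [|n].
    by have [L []] := U_split0; exists L.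
  by have [L [_ [[? _ _ _] [_ ? _]]]] := U_split n; exists L.
have [UB' B'P] := Xmx_compress u_cup u_cap XL XM UB BP (TPP n) LP LT.
eexists; split; [exact: UB' | exact: B'P |].
rewrite (compress_eig _ _ _ _ BT LT) ?exprS ?mulrA //.
apply: (schur_neq (@U_irr n.+2) (@U_irr n)); first by clear; lia.
apply: (intertwines_comp (TPP n.+1)).
exact: intertwines_comp (intertwines_tens u (TPP n)) (cap_intertwines u_cap (U n)).
Qed.

Lemma plus_eig n : Xmx X (U n) *m (TP n)%:S =
  ((nu * r ^+ 2) ^+ n * x0)%:A *: (tens1 (U n) *m (TP n)%:S).
Proof.
have [B [-> _ BT]] := Xmx_harmonic n.
by rewrite -mulmxA -map_mxM BT map_mxZ mulmx_scaleA.
Qed.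

(** X acts on V_{n+1}^- by some scalar y, by Schur's lemma.  Seeing U n as a
    summand of U n.+1 (x) u instead of U n.-1 (x) u then gives the scalar on
    V_n^-, which is nu r^2 y. *)
Lemma minus_eig_exists n : exists y,
  Xmx X (U n.+1) *m (TM n)%:S = y%:A *: (tens1 (U n.+1) *m (TM n)%:S) /\
  (if n isn't m.+1 then True else Xmx X (U m.+1) *m (TM m)%:S =
        (nu * r ^+ 2 * y)%:A *: (tens1 (U m.+1) *m (TM m)%:S)).
Proof.
have [B [UB BP _]] := Xmx_harmonic n.+1.
have [L1 [L2 [[L1T _ _ L2M] [TL L1P L2P]]]] := U_split n.
have BMP := intertwines_comp (TMP n) BP.
have L1BM : L1 *m (B *m TM n) = 0.
  apply: (schur_neq (@U_irr n) (@U_irr n.+2)); first by clear; lia.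
  exact: intertwines_comp BMP L1P.
have [//|y yE] := schur_scalar _ (@U_irr n) (intertwines_comp BMP L2P).
have BM : B *m TM n = y *: TM n.
  rewrite -[LHS]mul1mx -TL mulmxDl -!mulmxA L1BM mulmx0 add0r yE.
  exact: mul_mx_scalar.
exists y; split; first by rewrite UB -mulmxA -map_mxM BM map_mxZ mulmx_scaleA.
case: n => [//|m] in B UB BP L1 L2 L1T L2M TL L1P L2P BMP L1BM yE BM *.
have [UB' _] := Xmx_compress u_cup u_cap XL XM UB BP (TMP m.+1) L2P L2M.
rewrite UB' -(mulmxA (tens1 (U m.+1))) -map_mxM (compress_eig _ _ _ _ BM L2M);
  first by rewrite map_mxZ mulmx_scaleA.
apply: (schur_neq (@U_irr m) (@U_irr m.+2)); first by clear; lia.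
apply: (intertwines_comp (TMP m)).
exact: intertwines_comp (intertwines_tens u (TMP m.+1)) (cap_intertwines u_cap _).
Qed.

(** V_1^- is spanned by the cup, on which R acts as rho. *)
Lemma minus_eig0 : Xmx X (U 1) *m (TM 0)%:S =
  (nu * rho ^+ 2 * x0)%:A *: (tens1 (U 1) *m (TM 0)%:S).
Proof.
have [L [LT TL LP]] := U_split0.
have UB : Xmx X (U 0) = tens1 (U 0) *m (x0%:M)%:S.
  by rewrite U0_eq1 (Xmx1 XL X1) tens1_1 mul1mx.
have BP : intertwines (U 0 *t u) (U 0 *t u) x0%:M.
  by rewrite /intertwines mulmx_map_scalar mul_map_scalar_mx.
have [-> _] := Xmx_compress u_cup u_cap XL XM UB BP (TPP 0) LP LT.
rewrite -(mulmxA (tens1 (U 1))) -map_mxM.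
have [L1 [L2 [_ [TLM L1P L2P]]]] := U_split 0.
have cupP : intertwines (U 0) (U 1 *t u) (tens1 L *m cup C 1).
  exact: intertwines_comp (cup_intertwines u_cup (U 0)) (intertwines_tens u LP).
have L1c : L1 *m (tens1 L *m cup C 1) = 0.
  apply: (schur_neq (@U_irr 0) (@U_irr 2)) => //.
  exact: intertwines_comp cupP L1P.
have [m mE] : exists m, cup C 1 = m *: (tens1 (TP 0) *m TM 0).
  exists ((L2 *m (tens1 L *m cup C 1)) 0 0).
  rewrite scalemxAr -mul_mx_scalar -mx11_scalar.
  have -> : TM 0 *m (L2 *m (tens1 L *m cup C 1)) = tens1 L *m cup C 1.
    by rewrite -[RHS]mul1mx -TLM mulmxDl -!mulmxA L1c mulmx0 add0r.
  by rewrite mulmxA -tens1M TL tens1_1 mul1mx.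
have m0 : m != 0.
  apply: contra_neq delta0 => m0.
  have := cap_cup C D 1; rewrite mE m0 scale0r mulmx0 => /matrixP/(_ 0 0).
  by rewrite !mxE.
have RT : R23 C D r r' 1 *m (tens1 (TP 0) *m TM 0) = rho *: (tens1 (TP 0) *m TM 0).
  have := R23_cup C D r r' 1.
  rewrite mE -scalemxAr scalerA (mulrC _ m) -scalerA.
  by move/(congr1 (GRing.scale m^-1)); rewrite 2!(scalerA m^-1) mulVf // !scale1r.
rewrite tens1_scalar mul_mx_scalar -!scalemxAl -!scalemxAr -!scalemxAl.
rewrite -!mulmxA RT -scalemxAr RT -!scalemxAr.
rewrite mulmxA -tens1M LT tens1_1 mul1mx !scalerA.
rewrite map_mxZ mulmx_scaleA; congr (_%:A *: _); ring.
Qed.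

(** The counit turns U n.+1 into the identity matrix and so detects the
    scalar. *)
Lemma eps_cancel n (c : K) :
  c%:A *: (tens1 (U n.+1) *m (TM n)%:S) = 0 -> c = 0.
Proof.
have eps0 : eps 0 = 0 by have := epsL (-1) 0 0; rewrite scaler0 addr0 mulN1r addNr.
have epsD a b : eps (a + b) = eps a + eps b.
  by have := epsL 1 a b; rewrite scale1r mul1r.
have epsZ k a : eps (k *: a) = k * eps a.
  by have := epsL k a 0; rewrite !addr0 eps0 addr0.
move=> cT; apply/eqP/negPn/negP => c0; case/negP: (TM0 n); apply/eqP.
apply: matrix_ltensP => i j b; rewrite mxE.
have /matrixP/(_ (pr i j) b) := cT; rewrite mxE mul_tens1E mxE mulr_algl.
move/(congr1 eps); rewrite epsZ eps0 => /eqP; rewrite mulf_eq0 (negPf c0) /=.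
rewrite (big_morph _ epsD eps0) (bigD1 i) //= big1 ?addr0 => [|s si].
  by rewrite mxE mulr_algr epsZ epsU eqxx mulr1 => /eqP.
by rewrite mxE mulr_algr epsZ epsU eq_sym (negPf si) mulr0.
Qed.

Lemma minus_eig n : Xmx X (U n.+1) *m (TM n)%:S =
  (nu * rho ^+ 2 * x0 / (nu * r ^+ 2) ^+ n)%:A *: (tens1 (U n.+1) *m (TM n)%:S).
Proof.
elim: n => [|n IHn]; first by rewrite expr0 divr1 minus_eig0.
have [y [->]] := minus_eig_exists n.+1; rewrite IHn.
move/eqP; rewrite -subr_eq0 -!scalerBl => /eqP /eps_cancel /eqP.
rewrite subr_eq0 => /eqP yE; congr (_%:A *: _).
have nr : nu * r ^+ 2 != 0 by rewrite mulf_neq0 ?expf_neq0.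
apply: (mulfI nr); rewrite -yE (exprS _ n).
move: (nu * r ^+ 2) nr (expf_neq0 n nr) => a a0; move: (a ^+ n) => b b0.
by field; rewrite a0 b0.
Qed.
End Eig.
End Harmonic.

(** * Tables of R, of the metric and of the braiding invariants *)

Section Tables.
Variable (K : fieldType).

Lemma ord2P (P : 'I_2 -> Prop) : P 0 -> P 1 -> forall i, P i.
Proof.
move=> P0 P1 [[|[|//]] lti].
  by have -> : Ordinal lti = 0 by apply: val_inj.
by have -> : Ordinal lti = 1 by apply: val_inj.
Qed.

Lemma sum2 (V : nmodType) (F : 'I_2 -> V) : \sum_i F i = F 0 + F 1.
Proof.
by rewrite !big_ord_recl big_ord0 addr0; congr (_ + F _); apply: val_inj.
Qed.

Lemma big_index4 (V : nmodType) (F : index4 -> V) :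
  \sum_z F z = \sum_i \sum_j \sum_k \sum_l F (i, j, k, l).
Proof. by rewrite !pair_bigA; apply: eq_bigr => [[[[i j] k] l]] _. Qed.

(** Tables are entered through quad, row by row, so that they evaluate by
    computation once the indices are concrete. *)
Definition quad T (x00 x01 x10 x11 : T) (i j : 'I_2) : T :=
  if i == 0 then if j == 0 then x00 else x01 else if j == 0 then x10 else x11.

Variable p : K.
Hypothesis p0 : p != 0.

Lemma CupE : Cup p =2 quad 0 p^-1 (- p) 0.
Proof.
by apply: ord2P; apply: ord2P; rewrite /Cup /quad /= ?mulr0n ?mulr1n ?subr0 ?sub0r.
Qed.

Lemma CdnE : Cdn p =2 quad 0 (- p^-1) p 0.
Proof.
by apply: ord2P; apply: ord2P; rewrite /Cdn CupE /quad /= ?oppr0 ?opprK.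
Qed.

Lemma RhatE i j k l : Rhat p i j k l =
  quad (quad p 0 0 0 k l) (quad 0 (p - p ^- 3) p^-1 0 k l)
       (quad 0 p^-1 0 0 k l) (quad 0 0 0 p k l) i j.
Proof.
move: l k j i; do 4![apply: ord2P]; rewrite /Rhat CupE CdnE /quad /= ?mulr1n ?mulr0n.
all: by field.
Qed.

Lemma RinvE i j k l : Rinv p i j k l =
  quad (quad p^-1 0 0 0 k l) (quad 0 0 p 0 k l)
       (quad 0 p (p^-1 - p ^+ 3) 0 k l) (quad 0 0 0 p^-1 k l) i j.
Proof.
move: l k j i; do 4![apply: ord2P]; rewrite /Rinv CupE CdnE /quad /= ?mulr1n ?mulr0n.
all: by field.
Qed.

Lemma metric4E c1 i j k l : metric4 p c1 i j k l =
  quad (quad 0 0 0 (- c1) k l) (quad 0 (c1 * qhat p) c1 0 k l)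
       (quad 0 c1 0 0 k l) (quad (- (c1 * p ^+ 4)) 0 0 0 k l) i j.
Proof.
rewrite /metric4 !sum2 !CdnE !RinvE /qhat.
move: l k j i; do 4![apply: ord2P]; rewrite /quad /=.
all: by field.
Qed.

(** Applying a product of leg operators one factor at a time avoids the 16 by 16
    matrix of the braiding. *)
Lemma app_comp4 (M N : op4 K) w x :
  \sum_z comp4 M N x z * w z = \sum_y M x y * \sum_z N y z * w z.
Proof.
under eq_bigr do rewrite mulr_suml.
rewrite exchange_big; apply: eq_bigr => y _ /=; rewrite mulr_sumr.
by apply: eq_bigr => z _; rewrite mulrA.
Qed.

Lemma sum_delta (F : 'I_2 -> K) i : \sum_j F j *+ (i == j) = F i.
Proof.
rewrite (bigD1 i) //= eqxx big1 ?addr0 // => j.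
by rewrite eq_sym => /negPf->.
Qed.

Lemma leg12_app (X : tensor4 K) (w : index4 -> K) i j k l :
  \sum_z leg12 X (i, j, k, l) z * w z =
  \sum_a \sum_b X i j a b * w (a, b, k, l).
Proof.
rewrite big_index4; apply: eq_bigr => a _; apply: eq_bigr => b _.
rewrite -(sum_delta (fun k => X i j a b * w (a, b, k, l))).
apply: eq_bigr => c _; rewrite -(sum_delta (fun l => X i j a b * w (a, b, c, l))).
rewrite -sumrMnl; apply: eq_bigr => d _ /=.
by rewrite -mulrnA mulnb andbC mulrnAl.
Qed.

Lemma leg23_app (X : tensor4 K) (w : index4 -> K) i j k l :
  \sum_z leg23 X (i, j, k, l) z * w z =
  \sum_a \sum_b X j k a b * w (i, a, b, l).
Proof.
rewrite big_index4 -(sum_delta (fun i => \sum_a \sum_b X j k a b * w (i, a, b, l))).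
apply: eq_bigr => c _; rewrite -sumrMnl; apply: eq_bigr => a _.
rewrite -sumrMnl; apply: eq_bigr => b _ /=.
rewrite -(sum_delta (fun l => X j k a b * w (c, a, b, l))) -sumrMnl.
by apply: eq_bigr => d _; rewrite -mulrnA mulnb andbC mulrnAl.
Qed.

Lemma leg34_app (X : tensor4 K) (w : index4 -> K) i j k l :
  \sum_z leg34 X (i, j, k, l) z * w z =
  \sum_a \sum_b X k l a b * w (i, j, a, b).
Proof.
rewrite big_index4 -(sum_delta (fun i => \sum_a \sum_b X k l a b * w (i, j, a, b))).
apply: eq_bigr => c _.
rewrite -(sum_delta (fun j => \sum_a \sum_b X k l a b * w (c, j, a, b))) -sumrMnl.
apply: eq_bigr => d _; rewrite -!sumrMnl; apply: eq_bigr => a _.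
rewrite -!sumrMnl; apply: eq_bigr => b _ /=.
by rewrite -mulrnA mulnb andbC mulrnAl.
Qed.

(** Ten independent sigma-invariant tensors at once; the parameters are the coefficients
    of the pairs (ij, kl) below or on the diagonal of the table. *)
Definition braid_invariant (t1 t2 t3 t4 t5 t6 t7 t8 t9 t10 : K) (z : index4) : K :=
  let: (i, j, k, l) := z in
  quad (quad t1 (p ^+ 4 * t2) (qhat p * t2 + t4)
             (qhat p * t3 + (1 - p ^- 4) * t5 + t7) k l)
       (quad t2 t3 t5 (p ^+ 4 * t8) k l)
       (quad t4 t5 t6 (qhat p * t8 + t9) k l)
       (quad t7 t8 t9 t10 k l) i j.

Lemma braid4_invariant t1 t2 t3 t4 t5 t6 t7 t8 t9 t10 x :
  let w := braid_invariant t1 t2 t3 t4 t5 t6 t7 t8 t9 t10 in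
  \sum_z braid4 p x z * w z = w x.
Proof.
move: x => [[[i j] k] l] w; rewrite /braid4 !app_comp4.
move: l k j i; do 4![apply: ord2P].
all: rewrite leg23_app !sum2 !RhatE /quad /= ?mul0r ?addr0 ?add0r.
all: rewrite !leg12_app !sum2 !RhatE /quad /= ?mul0r ?addr0 ?add0r.
all: rewrite !leg34_app !sum2 !RinvE /quad /= ?mul0r ?addr0 ?add0r.
all: rewrite !leg23_app !sum2 !RinvE /quad /= ?mul0r ?addr0 ?add0r.
all: rewrite /w /braid_invariant /quad /= /qhat.
all: by field.
Qed.
End Tables.

(** * Bimodules and balanced tensor products *)

Section BimoduleTheory.
Variables (K : fieldType) (A : algType K) (M : bimodule A).

Lemma lact0 (a : A) : a *> (0 : M) = 0.
Proof. by apply: (addrI (a *> 0)); rewrite -lactDr !addr0. Qed.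

Lemma lact0l (x : M) : 0 *> x = 0.
Proof. by apply: (addrI (0 *> x)); rewrite -lactDl !addr0. Qed.

Lemma ract0 (a : A) : (0 : M) <* a = 0.
Proof. by apply: (addrI (0 <* a)); rewrite -ractDl !addr0. Qed.

Lemma lact_sum I (s : seq I) (P : pred I) (F : I -> M) (a : A) :
  a *> (\sum_(i <- s | P i) F i) = \sum_(i <- s | P i) a *> F i.
Proof. by apply: (big_morph _ (lactDr a)); exact: lact0. Qed.

Lemma lact_suml I (s : seq I) (P : pred I) (F : I -> A) (x : M) :
  (\sum_(i <- s | P i) F i) *> x = \sum_(i <- s | P i) F i *> x.
Proof.
by apply: (big_morph (fun a => a *> x)) => [a b|]; [exact: lactDl|exact: lact0l].
Qed.

Lemma ract_sum I (s : seq I) (P : pred I) (F : I -> M) (a : A) :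
  (\sum_(i <- s | P i) F i) <* a = \sum_(i <- s | P i) F i <* a.
Proof.
by apply: (big_morph (fun x => x <* a)) => [x y|]; [exact: ractDl|exact: ract0].
Qed.

Lemma lactNl (a : A) (x : M) : (- a) *> x = - (a *> x).
Proof. by apply: (addrI (a *> x)); rewrite -lactDl !subrr lact0l. Qed.

Lemma lact_scaleA (c : K) (a : A) (x : M) : (c *: a) *> x = c%:A *> (a *> x).
Proof. by rewrite lactA mulr_algl. Qed.

Lemma lact_scaleAr (c : K) (a : A) (x : M) : a *> (c%:A *> x) = (c *: a) *> x.
Proof. by rewrite lactA mulr_algr. Qed.

End BimoduleTheory.

Section TensorTheory.
Variables (K : fieldType) (A : algType K) (M N T : bimodule A).
Variables (t : M -> N -> T) (tP : is_tensor t).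

Lemma tens0l n : t 0 n = 0.
Proof.
by have [[tl _] _ _ _ _ _] := tP; apply: (addrI (t 0 n)); rewrite -tl !addr0.
Qed.

Lemma tens0r m : t m 0 = 0.
Proof.
by have [[_ tr] _ _ _ _ _] := tP; apply: (addrI (t m 0)); rewrite -tr !addr0.
Qed.

Lemma tens_suml I (s : seq I) (P : pred I) (F : I -> M) n :
  t (\sum_(i <- s | P i) F i) n = \sum_(i <- s | P i) t (F i) n.
Proof.
have [[tl _] _ _ _ _ _] := tP.
by apply: (big_morph (t^~ n)) => [x y|]; [exact: tl|exact: tens0l].
Qed.

Lemma tens_sumr I (s : seq I) (P : pred I) (F : I -> N) m :
  t m (\sum_(i <- s | P i) F i) = \sum_(i <- s | P i) t m (F i).
Proof.
have [[_ tr] _ _ _ _ _] := tP.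
by apply: (big_morph (t m)) => [x y|]; [exact: tr|exact: tens0r].
Qed.

Lemma tens_scaler m (c : K) n : t m (c%:A *> n) = c%:A *> t m n.
Proof. by rewrite -(tens_bal tP) -lractC (tens_lact tP). Qed.
End TensorTheory.

(** * The quadratic relations of the Clifford algebra *)

(** The elements x1, x2, x3, x4 are theta_11, theta_12, theta_21, theta_22.
    Since x3 and x4 kill w = x3 x4, the relations reduce every product of a
    generator with x1 x2 w, x1 w, x2 w or w to one of these words. *)
Section Words.
Variables (K : fieldType) (B : algType K) (x1 x2 x3 x4 : B) (q2 qh c d : K).
Hypotheses (x11 : x1 * x1 = 0) (x33 : x3 * x3 = 0) (x44 : x4 * x4 = 0).
Hypothesis x21 : x2 * x1 = - q2 *: (x1 * x2) - qh *: (x1 * x3).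
Hypothesis x22 : x2 * x2 = - qh *: (x1 * x4).
Hypothesis x31 : x3 * x1 = - (x1 * x3).
Hypothesis x32 : x3 * x2 = d *: (x1 * x4) - x2 * x3 + c%:A.
Hypothesis x41 : x4 * x1 = - (x1 * x4) - (q2 * c)%:A.
Hypothesis x42 : x4 * x2 = - q2 *: (x2 * x4) - qh *: (x3 * x4).
Hypothesis x43 : x4 * x3 = - (x3 * x4).
Local Notation w := (x3 * x4).

Lemma x3w : x3 * w = 0. Proof. by rewrite mulrA x33 mul0r. Qed.
Lemma x4w : x4 * w = 0.
Proof. by rewrite mulrA x43 mulNr -mulrA x44 mulr0 oppr0. Qed.
Lemma x1x1w z : x1 * (x1 * z) = 0. Proof. by rewrite mulrA x11 mul0r. Qed.
Lemma x2x1w : x2 * (x1 * w) = - q2 *: (x1 * (x2 * w)).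
Proof.
rewrite mulrA x21 mulrBl -!scalerAl -!mulrA (mulrA x3) x33 mul0r mulr0.
by rewrite scaler0 subr0.
Qed.
Lemma x2x2w : x2 * (x2 * w) = 0.
Proof. by rewrite mulrA x22 -scalerAl -mulrA x4w mulr0 scaler0. Qed.
Lemma x3x1w : x3 * (x1 * w) = 0.
Proof. by rewrite mulrA x31 mulNr -mulrA x3w mulr0 oppr0. Qed.
Lemma x3x2w : x3 * (x2 * w) = c *: w.
Proof.
rewrite mulrA x32 mulrDl mulrBl -scalerAl -!(mulrA _ _ w) x4w x3w.
by rewrite !mulr0 scaler0 subrr add0r mulr_algl.
Qed.
Lemma x4x1w : x4 * (x1 * w) = - (q2 * c) *: w.
Proof.
by rewrite mulrA x41 mulrBl mulNr -mulrA x4w mulr0 oppr0 sub0r mulr_algl scaleNr.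
Qed.
Lemma x4x2w : x4 * (x2 * w) = 0.
Proof.
rewrite mulrA x42 mulrBl -!scalerAl -!(mulrA _ _ w) x4w.
by rewrite !mulr0 !scaler0 subrr.
Qed.
Lemma x2x1x2w : x2 * (x1 * (x2 * w)) = - (qh * c) *: (x1 * w).
Proof.
rewrite mulrA x21 mulrBl -!scalerAl -!(mulrA _ _ (x2 * w)) x2x2w x3x2w.
by rewrite mulr0 scaler0 sub0r -scalerAr scalerA scaleNr.
Qed.
Lemma x3x1x2w : x3 * (x1 * (x2 * w)) = - c *: (x1 * w).
Proof. by rewrite mulrA x31 mulNr -mulrA x3x2w -scalerAr scaleNr. Qed.
Lemma x4x1x2w : x4 * (x1 * (x2 * w)) = - (q2 * c) *: (x2 * w).
Proof.
rewrite mulrA x41 mulrBl mulNr -mulrA x4x2w mulr0 oppr0 sub0r.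
by rewrite mulr_algl scaleNr.
Qed.

Lemma word_table :
  [/\ x1 * (x1 * (x2 * w)) = 0, x2 * (x1 * (x2 * w)) = - (qh * c) *: (x1 * w),
      x3 * (x1 * (x2 * w)) = - c *: (x1 * w) &
      x4 * (x1 * (x2 * w)) = - (q2 * c) *: (x2 * w)] /\
  [/\ x3 * w = 0, x4 * w = 0, x1 * (x1 * w) = 0 & x2 * (x2 * w) = 0] /\
  [/\ x2 * (x1 * w) = - q2 *: (x1 * (x2 * w)), x3 * (x1 * w) = 0,
      x4 * (x1 * w) = - (q2 * c) *: w, x3 * (x2 * w) = c *: w &
      x4 * (x2 * w) = 0].
Proof.
by rewrite !x1x1w x2x1x2w x3x1x2w x4x1x2w x3w x4w x2x2w x2x1w x3x1w x4x1w x3x2w x4x2w.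
Qed.
End Words.

Section Clifford.
Variables (K : fieldType) (p c1 : K) (A : algType K).
Hypothesis p0 : p != 0.
Variables (Gam : bimodule A) (th : 'I_2 -> 'I_2 -> Gam).
Variables (GG : bimodule A) (tGG : Gam -> Gam -> GG).
Hypothesis GG_tensor : is_tensor tGG.
Variables (sigma : {additive GG -> GG}) (g : {additive GG -> A}).
Hypothesis sigma_braiding : is_braiding p th tGG sigma.
Hypothesis g_metric : is_metric p th tGG c1 g.
Variables (TG : algType K) (jA : {lrmorphism A -> TG}) (jG : {additive Gam -> TG}).
Variables (Cl : algType K) (pi : {lrmorphism TG -> Cl}).
Hypothesis Cl_clifford : is_clifford tGG sigma g jA jG pi.

Local Notation e i j := (pi (jG (th i j))).

Lemma pijA_alg (c : K) : pi (jA c%:A) = c%:A.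
Proof. by rewrite !linearZ /= !rmorph1. Qed.

Lemma pijG_lact a x : pi (jG (a *> x)) = pi (jA a) * pi (jG x).
Proof.
by have [[H _] _ _] := cliff_talg Cl_clifford; rewrite H rmorphM.
Qed.

(** Every sigma-invariant tensor, paired with the generators, equals its metric
    in the Clifford algebra. *)
Lemma clifford_invariant (w : index4 -> K) :
  (forall x, \sum_z braid4 p x z * w z = w x) ->
  \sum_i \sum_j \sum_k \sum_l w (i, j, k, l) *: (e i j * e k l) =
  (\sum_i \sum_j \sum_k \sum_l w (i, j, k, l) * metric4 p c1 i j k l)%:A.
Proof.
move=> w_inv.
pose s := [seq ((w (i, j, k, l))%:A *> th i j, th k l) |
             '(i, j, k, l) <- enum {: index4}].
pose tt (z : index4) := let: (i, j, k, l) := z in tGG (th i j) (th k l).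
have rhoE : \sum_(y <- s) tGG y.1 y.2 = \sum_z (w z)%:A *> tt z.
  rewrite big_map big_enum; apply: eq_bigr => [[[[i j] k] l]] _ /=.
  by rewrite -(tens_lact GG_tensor).
have sig_rho : sigma (\sum_z (w z)%:A *> tt z) = \sum_z (w z)%:A *> tt z.
  have [sig_lin sigE] := sigma_braiding.
  rewrite raddf_sum /=.
  have -> : \sum_z sigma ((w z)%:A *> tt z) =
      \sum_z \sum_x (braid4 p x z * w z)%:A *> tt x.
    apply: eq_bigr => [[[[i j] k] l]] _; rewrite sig_lin sigE big_index4.
    rewrite lact_sum; apply: eq_bigr => a _; rewrite lact_sum; apply: eq_bigr => b _.
    rewrite lact_sum; apply: eq_bigr => c _; rewrite lact_sum; apply: eq_bigr => d _.
    by rewrite lact_scaleAr scalerA mulrC.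
  rewrite exchange_big; apply: eq_bigr => x _.
  by rewrite -lact_suml -scaler_suml w_inv.
have g_rho : g (\sum_z (w z)%:A *> tt z) =
    (\sum_i \sum_j \sum_k \sum_l w (i, j, k, l) * metric4 p c1 i j k l)%:A.
  have [g_lin gE] := g_metric.
  rewrite raddf_sum big_index4 scaler_suml; apply: eq_bigr => i _.
  rewrite scaler_suml; apply: eq_bigr => j _.
  rewrite scaler_suml; apply: eq_bigr => k _.
  rewrite scaler_suml; apply: eq_bigr => l _.
  by rewrite g_lin gE mulr_algl scalerA.
have /(cliff_ker Cl_clifford) : ideal_gen (clifford_gen tGG sigma g jA jG)
   (\sum_(y <- s) jG y.1 * jG y.2 - jA (g (\sum_(y <- s) tGG y.1 y.2))).
  by apply: ideal_gen_in; exists s; rewrite /= rhoE.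
rewrite rmorphB rhoE g_rho /= pijA_alg => /eqP; rewrite subr_eq0 => /eqP <-.
rewrite big_map big_enum rmorph_sum /= big_index4.
apply: eq_bigr => i _; apply: eq_bigr => j _.
apply: eq_bigr => k _; apply: eq_bigr => l _; rewrite /= rmorphM.
rewrite -[RHS]/(pi (jG ((w (i, j, k, l))%:A *> th i j)) * e k l).
by rewrite pijG_lact pijA_alg mulr_algl scalerAl.
Qed.

Lemma clifford_relations :
  [/\ e 0 0 * e 0 0 = 0, e 1 0 * e 1 0 = 0 & e 1 1 * e 1 1 = 0] /\
  [/\ e 0 1 * e 0 0 = - p ^+ 4 *: (e 0 0 * e 0 1) - qhat p *: (e 0 0 * e 1 0),
      e 0 1 * e 0 1 = - qhat p *: (e 0 0 * e 1 1),
      e 1 0 * e 0 0 = - (e 0 0 * e 1 0) &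
      e 1 0 * e 0 1 = (p ^- 4 - 1) *: (e 0 0 * e 1 1) - e 0 1 * e 1 0
                      + (c1 * (1 + p ^- 4))%:A] /\
  [/\ e 1 1 * e 0 0 = - (e 0 0 * e 1 1) - (p ^+ 4 * (c1 * (1 + p ^- 4)))%:A,
      e 1 1 * e 0 1 = - p ^+ 4 *: (e 0 1 * e 1 1) - qhat p *: (e 1 0 * e 1 1) &
      e 1 1 * e 1 0 = - (e 1 0 * e 1 1)].
Proof.
have rel t1 t2 t3 t4 t5 t6 t7 t8 t9 t10 :=
  clifford_invariant (braid4_invariant p0 t1 t2 t3 t4 t5 t6 t7 t8 t9 t10).
split; split.
- have := rel 1 0 0 0 0 0 0 0 0 0;
    rewrite !sum2 !metric4E // /braid_invariant /quad /=.
  rewrite ?(mulr0, mul0r, mulr1, mul1r, scale0r, scale1r, addr0, add0r) //.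
- have := rel 0 0 0 0 0 1 0 0 0 0;
    rewrite !sum2 !metric4E // /braid_invariant /quad /=.
  rewrite ?(mulr0, mul0r, mulr1, mul1r, scale0r, scale1r, addr0, add0r) //.
- have := rel 0 0 0 0 0 0 0 0 0 1;
    rewrite !sum2 !metric4E // /braid_invariant /quad /=.
  rewrite ?(mulr0, mul0r, mulr1, mul1r, scale0r, scale1r, addr0, add0r) //.
- split.
  + have := rel 0 1 0 0 0 0 0 0 0 0;
    rewrite !sum2 !metric4E // /braid_invariant /quad /=.
    rewrite ?(mulr0, mul0r, mulr1, mul1r, scale0r, scale1r, addr0, add0r) //.
    by move/(canRL (addKr _)) ->; rewrite addr0 opprD !scaleNr.
  + have := rel 0 0 1 0 0 0 0 0 0 0;
    rewrite !sum2 !metric4E // /braid_invariant /quad /=.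
    rewrite ?(mulr0, mul0r, mulr1, mul1r, scale0r, scale1r, addr0, add0r) //.
    by move/(canRL (addKr _)) ->; rewrite mulrN mulrC addNr scale0r addr0 scaleNr.
  + have := rel 0 0 0 1 0 0 0 0 0 0;
    rewrite !sum2 !metric4E // /braid_invariant /quad /=.
    rewrite ?(mulr0, mul0r, mulr1, mul1r, scale0r, scale1r, addr0, add0r) //.
    by move/(canRL (addKr _)) ->; rewrite addr0.
  + have := rel 0 0 0 0 1 0 0 0 0 0;
    rewrite !sum2 !metric4E // /braid_invariant /quad /=.
    rewrite ?(mulr0, mul0r, mulr1, mul1r, scale0r, scale1r, addr0, add0r) //.
    move/(canRL (addKr _)) ->; rewrite opprD -scaleNr opprB; congr (_ + _%:A); ring.
- split.
  + have := rel 0 0 0 0 0 0 1 0 0 0;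
    rewrite !sum2 !metric4E // /braid_invariant /quad /=.
    rewrite ?(mulr0, mul0r, mulr1, mul1r, scale0r, scale1r, addr0, add0r) //.
    by move/(canRL (addKr _)) ->; congr (_ + _); rewrite -scaleNr; congr (_%:A); field.
  + have := rel 0 0 0 0 0 0 0 1 0 0;
    rewrite !sum2 !metric4E // /braid_invariant /quad /=.
    rewrite ?(mulr0, mul0r, mulr1, mul1r, scale0r, scale1r, addr0, add0r) //.
    by rewrite addrA => /(canRL (addKr _)) ->; rewrite addr0 opprD !scaleNr.
  + have := rel 0 0 0 0 0 0 0 0 1 0;
    rewrite !sum2 !metric4E // /braid_invariant /quad /=.
    rewrite ?(mulr0, mul0r, mulr1, mul1r, scale0r, scale1r, addr0, add0r) //.
    by move/(canRL (addKr _)) ->; rewrite addr0.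
Qed.
End Clifford.

(** * Identities between the structure constants *)

Section SpinorTables.
Variables (K : fieldType) (p c1 : K).
Hypothesis p0 : p != 0.

(** The structure constants of theta_{rs} psi^+_i and theta_{rs} psi^-_i.  On
    psi^-, the second index of theta is contracted with that of psi and the
    first one remains; on psi^+, psi first passes the second index of theta
    and is then contracted with the first one.  Written in this way they are
    built from the invariants of u, whence the recursions below. *)
Definition cplus (r s i j : 'I_2) : K := - \sum_a Cdn p r a * Rinv p a j s i.
Definition cminus (r s i j : 'I_2) : K :=
  (- (brack2 p * c1 * p) * Cdn p s i) *+ (r == j).

Lemma cplusE r s i j : cplus r s i j =
  quad (quad 0 0 1 0 i j) (quad (- qhat p) 0 0 (p ^- 2) i j)
       (quad (- 1) 0 0 0 i j) (quad 0 (- p ^+ 2) 0 0 i j) r s.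
Proof.
rewrite /cplus !sum2 !CdnE !RinvE // /qhat.
move: j i s r; do 4![apply: ord2P]; rewrite /quad /=.
all: by field.
Qed.

Lemma cminusE r s i j : cminus r s i j =
  quad (quad 0 0 (brack2 p * c1) 0 i j) (quad (- (brack2 p * c1 * p ^+ 2)) 0 0 0 i j)
       (quad 0 0 0 (brack2 p * c1) i j)
       (quad 0 (- (brack2 p * c1 * p ^+ 2)) 0 0 i j) r s.
Proof.
rewrite /cminus !CdnE.
move: j i s r; do 4![apply: ord2P]; rewrite /quad /= ?mulr0n ?mulr1n.
all: by field.
Qed.

(** The factor in parentheses is the right multiplication of the calculus: moving
    u past theta and then multiplying with psi amounts to two braidings of u
    with psi. *)
Lemma cplus_recursion t v l m i j :
  \sum_r \sum_s (\sum_z Rhat p m r t z * Rinv p z s v l) * cplus r s i j =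
  \sum_d \sum_b \sum_e Rinv p m j d b * Rinv p e b l i * cplus t v e d.
Proof.
rewrite !sum2 !RhatE // !RinvE // !cplusE /qhat.
move: j i m l v t; do 6![apply: ord2P]; rewrite /quad /=.
all: rewrite ?(mul0r, mulr0, addr0, add0r).
all: by [field | rewrite ?(mul0r, mulr0, addr0, add0r)].
Qed.

Lemma cminus_recursion t v l m i j :
  \sum_r \sum_s (\sum_z Rhat p m r t z * Rinv p z s v l) * cminus r s i j =
  \sum_d \sum_b \sum_e Rhat p m j d b * Rhat p e b l i * cminus t v e d.
Proof.
rewrite !sum2 !RhatE // !RinvE // !cminusE.
move: j i m l v t; do 6![apply: ord2P]; rewrite /quad /=.
all: rewrite ?(mul0r, mulr0, addr0, add0r).
all: by [field | rewrite ?(mul0r, mulr0, addr0, add0r)].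
Qed.

(** Here and below the inverse of qhat becomes an opaque factor h: both sides
    are linear in it, so the identities are polynomial in p and p^-1. *)
Lemma theta_cplus i j :
  \sum_r \sum_s (p / qhat p * Cup p r s) * cplus r s i j =
  (p ^- 2 / qhat p) *+ (i == j).
Proof.
rewrite !sum2 !CupE !cplusE; move: (qhat p)^-1 => h.
move: j i; do 2![apply: ord2P]; rewrite /quad /= ?mulr0n ?mulr1n.
all: rewrite ?(mul0r, mulr0, addr0, add0r) /qhat //.
all: by field.
Qed.

Lemma theta_cminus i j :
  \sum_r \sum_s (p / qhat p * Cup p r s) * cminus r s i j =
  (- brack2 p * c1 * p ^+ 2 / qhat p) *+ (i == j).
Proof.
rewrite !sum2 !CupE !cminusE /brack2; move: (qhat p)^-1 => h.
move: j i; do 2![apply: ord2P]; rewrite /quad /= ?mulr0n ?mulr1n.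
all: rewrite ?(mul0r, mulr0, addr0, add0r) //.
all: by field.
Qed.

Lemma tau_cplus gamma eta m z : eta = 1 \/ eta = -1 ->
  \sum_j \sum_k (p / qhat p * Cup p j k) * (\sum_r \sum_s \sum_t \sum_l
    gamma * (p ^+ 2) ^+ (j.+1 + k.+1)%N * Rhat p s t l k * Rpow p eta r l m j *
    cplus r s t z) =
  (gamma * p ^ (7 - 3 * eta) / qhat p) *+ (m == z).
Proof.
case=> ->; rewrite /Rpow /=.
{ have -> : p ^ (7 - 3 * 1) = p ^+ 4 by [].
  rewrite !sum2 !RhatE // !CupE !cplusE; move: (qhat p)^-1 => h.
  move: z m; do 2![apply: ord2P]; rewrite /quad /= ?mulr0n ?mulr1n.
  all: rewrite ?(mul0r, mulr0, addr0, add0r) /qhat //.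
  all: rewrite -?[(1 %% 2)%N]/1%N; by field. }
{ have -> : p ^ (7 - 3 * -1) = p ^+ 10 by [].
  rewrite !sum2 !RhatE // !RinvE // !CupE !cplusE; move: (qhat p)^-1 => h.
  move: z m; do 2![apply: ord2P]; rewrite /quad /= ?mulr0n ?mulr1n.
  all: rewrite ?(mul0r, mulr0, addr0, add0r) /qhat //.
  all: rewrite -?[(1 %% 2)%N]/1%N; by field. }
Qed.

Lemma tau_cminus gamma eta m z : eta = 1 \/ eta = -1 ->
  \sum_j \sum_k (p / qhat p * Cup p j k) * (\sum_r \sum_s \sum_t \sum_l
    gamma * (p ^+ 2) ^+ (j.+1 + k.+1)%N * Rpow p eta s t l k * Rinv p r l m j *
    cminus r s t z) =
  (- brack2 p * c1 * gamma * p ^ (5 - 3 * eta) / qhat p) *+ (m == z).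
Proof.
case=> ->; rewrite /Rpow /=.
{ have -> : p ^ (5 - 3 * 1) = p ^+ 2 by [].
  rewrite !sum2 !RhatE // !RinvE // !CupE !cminusE /brack2; move: (qhat p)^-1 => h.
  move: z m; do 2![apply: ord2P]; rewrite /quad /= ?mulr0n ?mulr1n.
  all: rewrite ?(mul0r, mulr0, addr0, add0r) //.
  all: rewrite -?[(1 %% 2)%N]/1%N; by field. }
{ have -> : p ^ (5 - 3 * -1) = p ^+ 8 by [].
  rewrite !sum2 !RinvE // !CupE !cminusE /brack2; move: (qhat p)^-1 => h.
  move: z m; do 2![apply: ord2P]; rewrite /quad /= ?mulr0n ?mulr1n.
  all: rewrite ?(mul0r, mulr0, addr0, add0r) //.
  all: rewrite -?[(1 %% 2)%N]/1%N; by field. }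
Qed.
End SpinorTables.

(** * The Dirac operator in coordinates *)

Lemma scale_exchange (K : fieldType) (V : lmodType K) (I J : finType)
    (c : I -> K) (d : I -> J -> K) (y : J -> V) :
  \sum_i c i *: \sum_j d i j *: y j = \sum_j (\sum_i c i * d i j) *: y j.
Proof.
under eq_bigr do rewrite scaler_sumr.
rewrite exchange_big; apply: eq_bigr => j _; rewrite scaler_suml.
by apply: eq_bigr => i _; rewrite scalerA.
Qed.

Section Coordinates.
Variables (K : fieldType) (A : algType K) (M : bimodule A) (I : finType) (e : I -> M).
Hypothesis eP : left_basis e.

(** Coordinates chosen pointwise are linear because they are unique. *)
Lemma left_basis_coord : exists F : M -> I -> A,
  (forall x, x = \sum_i F x i *> e i) /\
  (forall a : I -> A, F (\sum_i a i *> e i) =1 a).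
Proof.
have /choice[F FP] : forall x, exists a : {ffun I -> A}, x = \sum_i a i *> e i.
  by move=> x; have [a [? _]] := eP x; exists a.
exists (fun x => F x); split=> // a i.
have [b [_ b_uniq]] := eP (\sum_i a i *> e i).
have <- : b = F (\sum_i a i *> e i) by apply: b_uniq.
have -> : b = [ffun i => a i]; last by rewrite ffunE.
by apply: b_uniq; apply: eq_bigr => j _; rewrite ffunE.
Qed.
End Coordinates.

Section Spinors.
Variables (K : fieldType) (p c1 nu0 : K) (A : algType K) (u : 'M[A]_2).
Hypotheses (p0 : p != 0) (c10 : c1 != 0) (b0 : brack2 p != 0).
Variables (Gam : bimodule A) (th : 'I_2 -> 'I_2 -> Gam).
Hypothesis Gam_4D : is_calculus4D p u th nu0.
Variables (GG : bimodule A) (tGG : Gam -> Gam -> GG).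
Hypothesis GG_tensor : is_tensor tGG.
Variables (sigma : {additive GG -> GG}) (g : {additive GG -> A}).
Hypothesis sigma_braiding : is_braiding p th tGG sigma.
Hypothesis g_metric : is_metric p th tGG c1 g.
Variables (TG : algType K) (jA : {lrmorphism A -> TG}) (jG : {additive Gam -> TG}).
Variables (Cl : algType K) (pi : {lrmorphism TG -> Cl}).
Hypothesis Cl_clifford : is_clifford tGG sigma g jA jG pi.
Variables (S0 : bimodule A) (emb : {additive S0 -> Cl}) (psip psim : 'I_2 -> S0).
Hypothesis S0_spinors : is_S0 p th (pi \o jA) (pi \o jG) c1 emb psip psim.
Variables (GS : bimodule A) (tGS : Gam -> S0 -> GS).
Hypothesis GS_tensor : is_tensor tGS.
Variable mul : {additive GS -> S0}.
Hypothesis mulE : is_clifford_mul (pi \o jG) emb tGS mul.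

Local Notation e i j := (pi (jG (th i j))).

Lemma emb_scale (c : K) x : emb (c%:A *> x) = c *: emb x.
Proof. by rewrite (S0_lact S0_spinors) /= pijA_alg mulr_algl. Qed.

Lemma mul_lact : left_linear mul.
Proof.
move=> a x; have [s ->] := tens_gen GS_tensor x.
rewrite lact_sum !raddf_sum lact_sum; apply: eq_bigr => y _ /=.
apply: (S0_inj S0_spinors).
rewrite (S0_lact S0_spinors) (tens_lact GS_tensor) !mulE /=.
by rewrite (pijG_lact Cl_clifford) mulrA.
Qed.

Let rel := clifford_relations p0 GG_tensor sigma_braiding g_metric Cl_clifford.
Local Notation w := (e 1 0 * e 1 1).

Local Notation c := (c1 * (1 + p ^- 4)).

(** The normalisation of psi^+_1 is chosen to cancel the metric constant. *)
Lemma coefK : p ^+ 2 / (brack2 p * c1) * c = 1.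
Proof.
have -> : c = p ^- 2 * (brack2 p * c1) by rewrite /brack2; field.
by rewrite mulrACA mulfV ?expf_neq0 // mulVf ?mulf_neq0 // mulr1.
Qed.

Lemma emb_spinors :
  [/\ emb (psip 0) = (p ^+ 2 / (brack2 p * c1)) *: (e 0 0 * (e 0 1 * w)),
      emb (psip 1) = w, emb (psim 0) = e 0 0 * w &
      emb (psim 1) = p ^+ 2 *: (e 0 1 * w)].
Proof.
rewrite (S0_psip1 S0_spinors) (S0_psip2 S0_spinors) (S0_psim1 S0_spinors).
by rewrite (S0_psim2 S0_spinors) /= -!mulrA.
Qed.

Lemma mul_psip r s i :
  mul (tGS (th r s) (psip i)) = \sum_j (cplus p r s i j)%:A *> psim j.
Proof.
apply: (S0_inj S0_spinors); rewrite mulE raddf_sum !sum2 /= !emb_scale.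
have [[x11 x33 x44] [[x21 x22 x31 x32] [x41 x42 x43]]] := rel.
have [[w1 w2 w3 w4] [[w5 w6 _ _] _]] :=
  word_table x11 x33 x44 x21 x22 x31 x32 x41 x42 x43.
have [emb1 emb2 emb3 emb4] := emb_spinors; rewrite emb3 emb4 !cplusE //.
move: i s r; do 3![apply: ord2P]; rewrite ?emb1 ?emb2 /quad /=
  ?(scale0r, scale1r, addr0, add0r) -?scalerAr ?scalerA.
- by rewrite w1 scaler0.
- by rewrite w3 scalerA mulrN coefK.
- by rewrite w2 scalerA mulrN mulrCA coefK mulr1.
- rewrite w4 // scalerA mulrN mulrCA coefK mulr1; congr (_ *: _).
  by ring.
- by [].
- exact: w5.
- by rewrite mulVf ?expf_neq0 // scale1r.
- exact: w6.
Qed.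

Lemma mul_psim r s i :
  mul (tGS (th r s) (psim i)) = \sum_j (cminus p c1 r s i j)%:A *> psip j.
Proof.
apply: (S0_inj S0_spinors); rewrite mulE raddf_sum !sum2 /= !emb_scale.
have [[x11 x33 x44] [[x21 x22 x31 x32] [x41 x42 x43]]] := rel.
have [_ [[_ _ w1 w2] [w3 w4 w5 w6 w7]]] :=
  word_table x11 x33 x44 x21 x22 x31 x32 x41 x42 x43.
have [emb1 emb2 emb3 emb4] := emb_spinors; rewrite emb1 emb2 !cminusE //.
move: i s r; do 3![apply: ord2P]; rewrite ?emb3 ?emb4 /quad /=
  ?(scale0r, scale1r, addr0, add0r) -?scalerAr ?scalerA.
- exact: w1.
- exact: w4.
- rewrite w3; by congr (_ *: _); field; rewrite ?p0 ?c10 ?b0.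
- rewrite w5; by congr (_ *: _); rewrite /brack2; field; rewrite ?p0.
- by congr (_ *: _); field; rewrite ?p0 ?c10 ?b0.
- rewrite w6 scalerA; by congr (_ *: _); rewrite /brack2; field; rewrite ?p0.
- by rewrite w2 scaler0.
- by rewrite w7 scaler0.
Qed.

Lemma tens_theta (N T : bimodule A) (t : N -> Gam -> T) x : is_tensor t ->
  t x (theta p th) =
  \sum_r \sum_s (p / qhat p * Cup p r s)%:A *> t x (th r s).
Proof.
move=> tP; rewrite /theta (tens_sumr tP); apply: eq_bigr => r _.
by rewrite (tens_sumr tP); apply: eq_bigr => s _; rewrite (tens_scaler tP).
Qed.

(** The two halves of the spinors are treated at once: cc is the table of
    products of the theta_{rs} with psi, with values in the span of psi'. *)
Section Operator.
Variables (psi psi' : 'I_2 -> S0) (cc : 'I_2 -> 'I_2 -> 'I_2 -> 'I_2 -> K).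
Hypothesis mul_psi : forall r s i,
  mul (tGS (th r s) (psi i)) = \sum_j (cc r s i j)%:A *> psi' j.
Variables (r r' x0 : K).
Hypothesis cc_recursion : forall t v l m i j,
  \sum_r \sum_s (\sum_z Rhat p m r t z * Rinv p z s v l) * cc r s i j =
  \sum_d \sum_b \sum_e Rgen (Cup p) (Cdn p) r r' m j d b *
    Rgen (Cup p) (Cdn p) r r' e b l i * cc t v e d.
Hypothesis theta_cc : forall i j,
  \sum_r \sum_s (p / qhat p * Cup p r s) * cc r s i j = x0 *+ (i == j).

(** X is the contraction with cc of the coordinates of theta a in the basis
    theta_{tv}; the right multiplication by u gives a recursion for these
    coordinates, which cc_recursion turns into one for X. *)
Lemma theta_operator : exists X : 'I_2 -> 'I_2 -> A -> A,
  [/\ forall i j (c : K) a b, X i j (c *: a + b) = c *: X i j a + X i j b,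
      forall i j, X i j 1 = (x0 *+ (i == j))%:A,
      forall i j a k l, X i j (a * u k l) =
        nu0 *: \sum_c \sum_d \sum_b \sum_e
          (Rgen (Cup p) (Cdn p) r r' c j d b * Rgen (Cup p) (Cdn p) r r' e b l i)
            *: (X e d a * u k c) &
      forall a : 'I_2 -> A,
      mul (tGS (theta p th) (\sum_i a i *> psi i)) =
      \sum_j (\sum_i X i j (a i)) *> psi' j].
Proof.
have [F [FK FE]] := left_basis_coord (calc_basis Gam_4D).
pose X i j a := \sum_t \sum_v cc t v i j *: F (theta p th <* a) (t, v).
have FS (a : 'I_2 -> 'I_2 -> A) t v :
    F (\sum_t \sum_v a t v *> th t v) (t, v) = a t v.
  by rewrite pair_bigA FE.
have XE (a : A) b : theta p th <* a = \sum_t \sum_v b t v *> th t v ->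
    forall i j, X i j a = \sum_t \sum_v cc t v i j *: b t v.
  move=> aE i j; apply: eq_bigr => t _; apply: eq_bigr => v _.
  by rewrite aE FS.
have thE a : theta p th <* a =
    \sum_t \sum_v F (theta p th <* a) (t, v) *> th t v.
  by rewrite {1}[LHS]FK pair_bigA; apply: eq_bigr => [[t v]] _.
exists X; split.
- move=> i j c a b.
  rewrite (XE _ (fun t v => c *: F (theta p th <* a) (t, v) +
                            F (theta p th <* b) (t, v))).
    rewrite /X scaler_sumr -big_split; apply: eq_bigr => t _ /=.
    rewrite scaler_sumr -big_split; apply: eq_bigr => v _ /=.
    by rewrite scalerDr !scalerA mulrC.
  rewrite ractDr -mulr_algl -ractA -lractC -lractA.
  rewrite [X in _ *> X]thE [X in _ + X]thE lact_sum -big_split.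
  apply: eq_bigr => t _ /=; rewrite lact_sum -big_split; apply: eq_bigr => v _ /=.
  by rewrite lactA -lactDl mulr_algl.
- move=> i j; rewrite -theta_cc scaler_suml.
  rewrite (XE _ (fun t v => (p / qhat p * Cup p t v)%:A)) ?ract1 //.
  apply: eq_bigr => t _; rewrite scaler_suml; apply: eq_bigr => v _.
  by rewrite scalerA mulrC.
- move=> i j a k l.
  pose f tv := F (theta p th <* a) tv.
  pose q m r s tv := nu0 * \sum_z Rhat p m r tv.1 z * Rinv p z s tv.2 l.
  rewrite (XE _ (fun r s => \sum_m \sum_tv q m r s tv *: (f tv * u k m))).
    under eq_bigr => r1 _ do under eq_bigr => s1 _ do rewrite scaler_sumr.
    under eq_bigr => r1 _ do rewrite exchange_big.
    rewrite exchange_big scaler_sumr; apply: eq_bigr => m _ /=.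
    have XU d b : X b d a * u k m = \sum_tv cc tv.1 tv.2 b d *: (f tv * u k m).
      rewrite /X pair_bigA mulr_suml; apply: eq_bigr => [[t v]] _.
      by rewrite scalerAl.
    under [X in nu0 *: X]eq_bigr do under eq_bigr do under eq_bigr do
      rewrite XU.
    rewrite !pair_bigA /= !scale_exchange scaler_sumr.
    apply: eq_bigr => [[t v]] _ /=; rewrite scalerA; congr (_ *: _).
    have := cc_recursion t v l m i j; rewrite !pair_bigA /= => <-.
    rewrite mulr_sumr; apply: eq_bigr => [[r1 s1]] _; rewrite /q /=.
    by rewrite mulrCA; congr (_ * _); rewrite mulrC.
  have -> : theta p th <* (a * u k l) =
      \sum_tv f tv *> (th tv.1 tv.2 <* u k l).
    rewrite -ractA {1}[theta p th <* a]FK ract_sum; apply: eq_bigr => [[t v]] _.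
    by rewrite lractA.
  have fth tv : f tv *> (th tv.1 tv.2 <* u k l) = \sum_m \sum_r1 \sum_s1
      (q m r1 s1 tv *: (f tv * u k m)) *> th r1 s1.
    rewrite (calc_ract Gam_4D) lact_sum; apply: eq_bigr => m _.
    rewrite lact_sum; apply: eq_bigr => r1 _.
    rewrite lact_sum; apply: eq_bigr => s1 _.
    rewrite -lact_suml lactA; congr (_ *> _).
    rewrite -scaler_suml -scalerAr; congr (_ *: _).
    by rewrite /q mulr_sumr; apply: eq_bigr => z _; rewrite mulrA.
  under eq_bigr do rewrite fth.
  under [RHS]eq_bigr do under eq_bigr do rewrite lact_suml.
  under [RHS]eq_bigr do under eq_bigr do under eq_bigr do rewrite lact_suml.
  rewrite exchange_big /=.
  under [RHS]eq_bigr do rewrite exchange_big /=.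
  rewrite [RHS]exchange_big /=; apply: eq_bigr => m _.
  rewrite exchange_big /=; apply: eq_bigr => r1 _.
  by rewrite exchange_big.
- move=> a; rewrite (tens_sumr GS_tensor) raddf_sum.
  under [RHS]eq_bigr do rewrite lact_suml.
  rewrite exchange_big; apply: eq_bigr => i _ /=.
  rewrite -(tens_bal GS_tensor) thE !(tens_suml GS_tensor) raddf_sum.
  under [RHS]eq_bigr do rewrite /X lact_suml.
  rewrite exchange_big; apply: eq_bigr => t _ /=.
  under [RHS]eq_bigr do rewrite lact_suml.
  rewrite (tens_suml GS_tensor) raddf_sum exchange_big; apply: eq_bigr => v _ /=.
  rewrite -(tens_lact GS_tensor) mul_lact mul_psi lact_sum; apply: eq_bigr => j _.
  by rewrite lact_scaleAr.
Qed.

Variables (SG : bimodule A) (tSG : S0 -> Gam -> SG).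
Hypothesis SG_tensor : is_tensor tSG.
Variable tau : {additive SG -> GS}.
Hypothesis tau_lin : left_linear tau.
Variable ct : 'I_2 -> 'I_2 -> 'I_2 -> 'I_2 -> 'I_2 -> 'I_2 -> 'I_2 -> K.
Hypothesis tau_psi : forall m j k, tau (tSG (psi m) (th j k)) =
  \sum_r \sum_s \sum_t \sum_l (ct m j k r s t l)%:A *> tGS (th r s) (psi t).
Variable t0 : K.
Hypothesis ct_cc : forall m z,
  \sum_j \sum_k (p / qhat p * Cup p j k) *
    (\sum_r \sum_s \sum_t \sum_l ct m j k r s t l * cc r s t z) = t0 *+ (m == z).

(** Everything is left linear, so this operator is known from the value of
    tau (psi_m (x) theta). *)
Lemma tau_operator (a : 'I_2 -> A) :
  mul (tau (tSG (\sum_i a i *> psi i) (theta p th))) =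
  \sum_j (t0 *: a j) *> psi' j.
Proof.
have tau_th m : mul (tau (tSG (psi m) (theta p th))) = t0%:A *> psi' m.
  rewrite (tens_theta _ SG_tensor) !raddf_sum /=.
  transitivity (\sum_z (t0 *+ (m == z))%:A *> psi' z); last first.
    rewrite (bigD1 m) //= eqxx mulr1n big1 ?addr0 // => z zm.
    by rewrite eq_sym (negPf zm) mulr0n scale0r lact0l.
  under [RHS]eq_bigr do rewrite -ct_cc scaler_suml lact_suml.
  rewrite exchange_big; apply: eq_bigr => j _ /=.
  under [RHS]eq_bigr do rewrite scaler_suml lact_suml.
  rewrite exchange_big !raddf_sum; apply: eq_bigr => k _ /=.
  under [RHS]eq_bigr do rewrite -scalerA -[_ *: _%:A]mulr_algl -lactA.
  rewrite tau_lin mul_lact -lact_sum; congr (_ *> _).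
  rewrite tau_psi raddf_sum /=.
  under [RHS]eq_bigr do rewrite scaler_suml lact_suml.
  rewrite exchange_big; apply: eq_bigr => r1 _ /=; rewrite raddf_sum /=.
  under [RHS]eq_bigr do rewrite scaler_suml lact_suml.
  rewrite exchange_big; apply: eq_bigr => s1 _ /=; rewrite raddf_sum /=.
  under [RHS]eq_bigr do rewrite scaler_suml lact_suml.
  rewrite exchange_big; apply: eq_bigr => t _ /=; rewrite raddf_sum /=.
  under [RHS]eq_bigr do rewrite scaler_suml lact_suml.
  rewrite exchange_big; apply: eq_bigr => l _ /=.
  rewrite mul_lact mul_psi lact_sum; apply: eq_bigr => z _.
  by rewrite lactA mulr_algl scalerA.
rewrite (tens_suml SG_tensor) !raddf_sum; apply: eq_bigr => i _ /=.
by rewrite -(tens_lact SG_tensor) tau_lin mul_lact tau_th lact_scaleAr.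
Qed.
End Operator.
End Spinors.

(** * Spans, sums of subspaces and eigenvectors *)

Section LinSpan.
Variables (K : fieldType) (A : algType K) (M : bimodule A) (I : finType) (e : I -> M).

Lemma lin_span0 : lin_span e 0.
Proof. by exists (fun=> 0); rewrite big1 // => i _; rewrite scale0r lact0l. Qed.

Lemma lin_spanD x y : lin_span e x -> lin_span e y -> lin_span e (x + y).
Proof.
move=> [a ->] [b ->]; exists (fun i => a i + b i); rewrite -big_split.
by apply: eq_bigr => i _; rewrite scalerDl lactDl.
Qed.

Lemma lin_spanZ (c : K) x : lin_span e x -> lin_span e (c%:A *> x).
Proof.
move=> [a ->]; exists (fun i => c * a i); rewrite lact_sum.
by apply: eq_bigr => i _; rewrite lactA mulr_algl scalerA.
Qed.

Lemma lin_span_gen i : lin_span e (e i).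
Proof.
exists (fun j => (j == i)%:R); rewrite (bigD1 i) //= eqxx scale1r lact1.
by rewrite big1 ?addr0 // => j /negPf->; rewrite scale0r lact0l.
Qed.

Lemma lin_span_sum J (r : seq J) (P : pred J) (F : J -> M) :
  (forall j, lin_span e (F j)) -> lin_span e (\sum_(j <- r | P j) F j).
Proof. by move=> H; apply: big_ind => //; [exact: lin_span0 | exact: lin_spanD]. Qed.
End LinSpan.

Section DirectSum.
Variables (M : zmodType) (I : eqType) (V : I -> M -> Prop).
Hypothesis V0 : forall i, V i 0.
Hypothesis VD : forall i x y, V i x -> V i y -> V i (x + y).

Definition sum_of (x : M) : Prop := exists (s : seq I) (y : I -> M),
  [/\ uniq s, forall i, V i (y i) & x = \sum_(i <- s) y i].

Lemma sum_of0 : sum_of 0.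
Proof. by exists [::], (fun=> 0); split=> //; rewrite big_nil. Qed.

Lemma sum_of_gen i x : V i x -> sum_of x.
Proof.
move=> Vx; exists [:: i], (fun j => if j == i then x else 0); split=> //.
- by move=> j; case: eqP => [->|].
- by rewrite big_seq1 eqxx.
Qed.

(** Extending the range of a sum by zeros, so that two sums over different
    index sets can be added. *)
Lemma sum_of_widen (s t : seq I) (y : I -> M) : uniq s -> uniq t ->
  {subset s <= t} ->
  \sum_(i <- s) y i = \sum_(i <- t) (if i \in s then y i else 0).
Proof.
move=> us ut st; rewrite -big_mkcond -big_filter; apply: perm_big.
apply: uniq_perm; rewrite ?filter_uniq // => i; rewrite mem_filter.
by case: (boolP (i \in s)) => // /st ->.
Qed.

Lemma sum_ofD x x' : sum_of x -> sum_of x' -> sum_of (x + x').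
Proof.
move=> [s [y [us Vy ->]]] [s' [y' [us' Vy' ->]]].
exists (undup (s ++ s')),
  (fun i => (if i \in s then y i else 0) + (if i \in s' then y' i else 0)).
split; first exact: undup_uniq.
- by move=> i; apply: VD; case: ifP.
- rewrite big_split /=; congr (_ + _); apply: sum_of_widen; rewrite ?undup_uniq //.
  + by move=> i is_; rewrite mem_undup mem_cat is_.
  + by move=> i is_; rewrite mem_undup mem_cat is_ orbT.
Qed.

Lemma sum_of_sum J (r : seq J) (P : pred J) (F : J -> M) :
  (forall j, sum_of (F j)) -> sum_of (\sum_(j <- r | P j) F j).
Proof. by move=> H; apply: big_ind => //; [exact: sum_of0 | exact: sum_ofD]. Qed.
End DirectSum.

Section Eigenvectors.
Variables (K : fieldType) (A : algType K) (X : 'I_2 -> 'I_2 -> A -> A).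
Hypothesis XL : forall i j (c : K) a b, X i j (c *: a + b) = c *: X i j a + X i j b.

Definition eigenvector (a : 'I_2 -> A) (l : K) : Prop :=
  forall j, \sum_i X i j (a i) = l *: a j.

(** Applying X and subtracting l i0 times the sum removes the first term; here
    eigenvectors are given by their coordinates over A. *)
Lemma eigenvector_indep (I : eqType) (s : seq I) (a : I -> 'I_2 -> A) (l : I -> K) :
  uniq s -> injective l -> (forall i, eigenvector (a i) (l i)) ->
  (forall j, \sum_(i <- s) a i j = 0) -> forall i, i \in s -> forall j, a i j = 0.
Proof.
move=> us l_inj; elim: s a us => [//|i0 s IHs] a /= /andP[i0s us] aP a0.
have sumX j : \sum_(i <- i0 :: s) l i *: a i j = 0.
  transitivity (\sum_k X k j (\sum_(i <- i0 :: s) a i k)); last first.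
    by apply: big1 => k _; rewrite a0 (X0 XL).
  under eq_bigr do rewrite -aP.
  by rewrite exchange_big; apply: eq_bigr => k _; rewrite (Xsum XL).
have as0 i : i \in s -> forall j, a i j = 0.
  move=> is_ j; have : (l i - l i0) *: a i j = 0.
    apply: (IHs (fun i j => (l i - l i0) *: a i j)) is_ j => //.
    - move=> i1 j; under eq_bigr do rewrite (XZ XL).
      by rewrite -scaler_sumr aP !scalerA mulrC.
    - move=> j1.
      have : \sum_(i <- i0 :: s) (l i - l i0) *: a i j1 = 0.
        under eq_bigr do rewrite scalerBl.
        by rewrite sumrB sumX -scaler_sumr a0 scaler0 subr0.
      by rewrite big_cons subrr scale0r add0r.
  move/eqP; rewrite scaler_eq0 subr_eq0 (inj_eq l_inj) => /orP[/eqP ii0|/eqP//].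
  by rewrite -ii0 is_ in i0s.
move=> i; rewrite inE => /orP[/eqP-> j|/as0//].
have := a0 j; rewrite big_cons big_seq big1 ?addr0 // => i1 i1s; exact: as0.
Qed.
End Eigenvectors.

(** * The invariants of the fundamental corepresentation *)

Section QuantumPlane.
Variables (K : fieldType) (p : K) (A : algType K) (u : 'M[A]_2).
Hypotheses (p0 : p != 0) (uP : SLq2_rel p u).

Lemma sum_Rhat_l i j (y : 'I_2 -> 'I_2 -> A) :
  \sum_k \sum_l Rhat p i j k l *: y k l =
  p *: y i j + (p^-1 * Cup p i j) *: \sum_k \sum_l Cdn p k l *: y k l.
Proof.
rewrite scaler_sumr (bigD1 i) //= [in RHS](bigD1 i) //= addrA; congr (_ + _).
  rewrite scaler_sumr (bigD1 j) //= [in RHS](bigD1 j) //= addrA; congr (_ + _).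
    by rewrite /Rhat !eqxx mulr1n scalerDl scalerA.
  apply: eq_bigr => l lj; rewrite /Rhat eqxx eq_sym (negPf lj) mulr0n add0r.
  by rewrite scalerA.
apply: eq_bigr => k ki; rewrite scaler_sumr; apply: eq_bigr => l _.
by rewrite /Rhat eq_sym (negPf ki) mulr0n add0r scalerA.
Qed.

Lemma sum_Rhat_r m n (y : 'I_2 -> 'I_2 -> A) :
  \sum_k \sum_l Rhat p k l m n *: y k l =
  p *: y m n + (p^-1 * Cdn p m n) *: \sum_k \sum_l Cup p k l *: y k l.
Proof.
rewrite scaler_sumr (bigD1 m) //= [in RHS](bigD1 m) //= addrA; congr (_ + _).
  rewrite scaler_sumr (bigD1 n) //= [in RHS](bigD1 n) //= addrA; congr (_ + _).
    by rewrite /Rhat !eqxx mulr1n scalerDl scalerA mulrAC.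
  apply: eq_bigr => l lj; rewrite /Rhat eqxx (negPf lj) mulr0n add0r.
  by rewrite scalerA mulrAC.
apply: eq_bigr => k ki; rewrite scaler_sumr; apply: eq_bigr => l _.
by rewrite /Rhat (negPf ki) mulr0n add0r scalerA mulrAC.
Qed.

(** The defining relation says that Rhat, hence cup cap, commutes with u (x) u. *)
Lemma cup_cap_exchange i j m n :
  Cup p i j *: (\sum_k \sum_l Cdn p k l *: (u k m * u l n)) =
  Cdn p m n *: (\sum_k \sum_l Cup p k l *: (u i k * u j l)).
Proof.
have [/(_ i j m n) e _] := uP; move: e.
rewrite (sum_Rhat_l i j (fun k l => u k m * u l n)).
rewrite (sum_Rhat_r m n (fun k l => u i k * u j l)) => /addrI.
move/(congr1 (GRing.scale p)).
by rewrite !scalerA !mulrA mulfV // !mul1r.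
Qed.

Lemma cup01 : \sum_k \sum_l Cup p k l *: (u 0 k * u 1 l) = (p^-1)%:A.
Proof.
have [_ det1] := uP; rewrite -det1 scalerBr !sum2 !CupE /quad /=.
rewrite !scale0r add0r addr0 scaleNr scalerA; congr (_ - _ *: _).
by rewrite expr2 mulKf.
Qed.

Lemma cap01 : \sum_k \sum_l Cdn p k l *: (u k 0 * u l 1) = (- p^-1)%:A.
Proof.
have := cup_cap_exchange 0 1 0 1; rewrite cup01 CupE CdnE /quad /=.
rewrite scaleNr -scalerN -scaleNr => /(congr1 (GRing.scale p)).
by rewrite !scalerA mulfV // mul1r scale1r.
Qed.

Lemma u_cup i j : \sum_k \sum_l Cup p k l *: (u i k * u j l) = (Cup p i j)%:A.
Proof.
have := cup_cap_exchange i j 0 1; rewrite cap01 CdnE /quad /=.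
move/(congr1 (GRing.scale (- p))); rewrite !scalerA mulrNN mulfV // scale1r => <-.
by congr (_%:A); field.
Qed.

Lemma u_cap i j : \sum_k \sum_l Cdn p k l *: (u k i * u l j) = (Cdn p i j)%:A.
Proof.
have := cup_cap_exchange 0 1 i j; rewrite cup01 CupE /quad /=.
move/(congr1 (GRing.scale p)); rewrite !scalerA mulfV // scale1r => ->.
by congr (_%:A); field.
Qed.
End QuantumPlane.

(** * Clebsch-Gordan matrices and the spaces V *)

Section ClebschGordan.
Variables (K : fieldType) (A : algType K) (u : 'M[A]_2).
Local Notation "T %:S" := (map_mx (in_alg A) T) (at level 2, format "T %:S").
Local Notation pr i j := (mxtens_index (i, j)).

Definition cgmx n k (T : 'I_n -> 'I_2 -> 'I_k -> K) : 'M[K]_(n * 2, k) :=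
  \matrix_(x, b) T (mxtens_unindex x).1 (mxtens_unindex x).2 b.

Lemma cgmxE n k (T : 'I_n -> 'I_2 -> 'I_k -> K) s i b :
  cgmx T (pr s i) b = T s i b.
Proof. by rewrite mxE mxtens_indexK. Qed.

Lemma CG_intertwines n k (v : 'M[A]_n) (w : 'M[A]_k) T :
  is_CG u v w T -> intertwines w (v *t u) (cgmx T) /\ cgmx T != 0.
Proof.
move=> [[s [i [b T0]]] TP]; split.
  apply: matrix_ltensP => r j c; rewrite [RHS]mxE.
  under eq_bigr do rewrite mxE cgmxE mulr_algl.
  rewrite -TP mxE big_tens; apply: eq_bigr => s1 _; apply: eq_bigr => i1 _.
  by rewrite tensmxE mxE cgmxE mulr_algr.
by apply: contra_neq T0 => T0; rewrite -cgmxE T0 mxE.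
Qed.

Variable X : 'I_2 -> 'I_2 -> A -> A.
Hypothesis XL : forall i j (c : K) a b, X i j (c *: a + b) = c *: X i j a + X i j b.

Lemma eigenvector_harmonic n k (v : 'M[A]_n) (T : 'I_n -> 'I_2 -> 'I_k -> K) l :
  Xmx X v *m (cgmx T)%:S = l%:A *: (tens1 v *m (cgmx T)%:S) ->
  forall r b, eigenvector X (fun i => \sum_s T s i b *: v r s) l.
Proof.
move=> e r b j; have /matrixP/(_ (pr r j) b) := e.
rewrite mxE big_tens [RHS]mxE mul_tens1E mulr_algl exchange_big /= => e'.
transitivity (\sum_i \sum_s Xmx X v (pr r j) (pr s i) * (cgmx T)%:S (pr s i) b).
  apply: eq_bigr => i _; rewrite (Xsum XL); apply: eq_bigr => s _.
  by rewrite XmxE mxE cgmxE mulr_algr (XZ XL).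
rewrite e'; congr (_ *: _); apply: eq_bigr => s _.
by rewrite mxE cgmxE mulr_algr.
Qed.
End ClebschGordan.

(** The coordinates a are K-combinations of those of the generators, so they
    share every eigenvalue that all generators have in common. *)
Lemma Vspan_coord (K : fieldType) (A : algType K) (S : bimodule A)
    (psi : 'I_2 -> S) (U : forall n, 'M[A]_n.+1) n k
    (T : 'I_n.+1 -> 'I_2 -> 'I_k -> K) x :
  Vspan psi U T x -> exists a, x = \sum_i a i *> psi i /\
  forall X l, (forall i j (c : K) a b, X i j (c *: a + b) = c *: X i j a + X i j b) ->
    (forall r b, eigenvector X (fun i => \sum_s T s i b *: U n r s) l) ->
    eigenvector X a l.
Proof.
move=> [c ->].
exists (fun i => \sum_rb c rb *: \sum_s T s i rb.2 *: U n rb.1 s); split.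
  under [RHS]eq_bigr do rewrite lact_suml.
  rewrite exchange_big; apply: eq_bigr => rb _ /=.
  rewrite exchange_big lact_sum; apply: eq_bigr => i _ /=.
  by rewrite -lact_suml lactA mulr_algl.
move=> X l XL e j.
under eq_bigr do rewrite (Xsum XL).
rewrite exchange_big scaler_sumr; apply: eq_bigr => rb _ /=.
under eq_bigr do rewrite (XZ XL).
by rewrite -scaler_sumr e !scalerA mulrC.
Qed.

(** * The harmonics span *)

Section Spanning.
Variables (K : closedFieldType) (A : algType K) (u : 'M[A]_2).
Local Notation "T %:S" := (map_mx (in_alg A) T) (at level 2, format "T %:S").
Local Notation pr i j := (mxtens_index (i, j)).
Hypothesis u_gen : generates (fun x => exists i j, x = u i j).
Variable U : forall n, 'M[A]_n.+1.
Variable TP : forall n, 'M[K]_(n.+1 * 2, n.+2).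
Variable TM : forall n, 'M[K]_(n.+2 * 2, n.+1).
Hypothesis U_irr : forall n, irreducible (U n).
Hypothesis TPP : forall n, intertwines (U n.+1) (U n *t u) (TP n).
Hypothesis TMP : forall n, intertwines (U n) (U n.+1 *t u) (TM n).
Hypothesis TP0 : forall n, TP n != 0.
Hypothesis TM0 : forall n, TM n != 0.
Hypothesis U0_eq1 : U 0 = 1%:M.

(** The K-linear span of the matrix coefficients, as an intersection of
    predicates. *)
Definition coef_span (a : A) : Prop := forall H : A -> Prop,
  H 0 -> (forall x y, H x -> H y -> H (x + y)) ->
  (forall c n r s, H (c *: U n r s)) -> H a.

Lemma coef_span0 : coef_span 0. Proof. by []. Qed.

Lemma coef_spanD a b : coef_span a -> coef_span b -> coef_span (a + b).
Proof. by move=> Ha Hb H H0 HD HU; apply: (HD); [exact: Ha | exact: Hb]. Qed.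

Lemma coef_spanZ c a : coef_span a -> coef_span (c *: a).
Proof.
move=> Ha; apply: (Ha (fun a => coef_span (c *: a))).
- by rewrite scaler0.
- by move=> x y; rewrite scalerDr; apply: coef_spanD.
- by move=> d n r s H H0 HD HU; rewrite scalerA.
Qed.

Lemma coef_span_mulmx m k n (f : 'M[K]_(m, n.+1)) (g : 'M[K]_(n.+1, k)) i j :
  coef_span ((f%:S *m U n *m g%:S) i j).
Proof.
rewrite mxE; apply: big_ind => [||y _]; [exact: coef_span0 | exact: coef_spanD |].
rewrite mxE mulr_suml; apply: big_ind => [||x _];
  [exact: coef_span0 | exact: coef_spanD |].
rewrite !mxE mulr_algr mulr_algl; apply: coef_spanZ.
by move=> H H0 HD HU.
Qed.

(** The entries of U n (x) u are combinations of those of its summands. *)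
Lemma coef_span_mulu a k l : coef_span a -> coef_span (a * u k l).
Proof.
move=> Ha; apply: (Ha (fun a => coef_span (a * u k l))).
- by rewrite mul0r; exact: coef_span0.
- by move=> x y; rewrite mulrDl; apply: coef_spanD.
move=> c n r s; rewrite -scalerAl -(tensmxE (U n) u); apply: coef_spanZ.
case: n r s => [|n] r s.
  have [L [LT TL LP]] := U_split0 U_irr TPP TP0.
  have -> : U 0 *t u = (TP 0)%:S *m U 1 *m L%:S.
    by rewrite -TPP -mulmxA -map_mxM TL map_mx1 mulmx1.
  exact: coef_span_mulmx.
have [L1 [L2 [_ [TL L1P L2P]]]] := U_split U_irr TPP TMP TP0 TM0 n.
have -> : U n.+1 *t u = (TP n.+1)%:S *m U n.+2 *m L1%:S + (TM n)%:S *m U n *m L2%:S.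
  rewrite -TPP -TMP -!mulmxA -!map_mxM -mulmxDr -map_mxD TL.
  by rewrite map_mx1 mulmx1.
by rewrite mxE; apply: coef_spanD; exact: coef_span_mulmx.
Qed.

Lemma coef_spanT a : coef_span a.
Proof.
suff: forall b, coef_span b -> coef_span (b * a).
  move=> /(_ 1); rewrite mul1r; apply=> H H0 HD HU.
  by have := HU 1 0%N 0 0; rewrite U0_eq1 mxE eqxx scale1r.
apply: (u_gen (P := fun a => forall b, coef_span b -> coef_span (b * a))) a.
- by move=> c b Hb; rewrite mulr_algr; apply: coef_spanZ.
- by move=> x y Hx Hy b Hb; rewrite mulrDr; exact: coef_spanD (Hx _ Hb) (Hy _ Hb).
- by move=> x y Hx Hy b Hb; rewrite mulrA; exact: Hy (Hx _ Hb).
- by move=> _ [i [j ->]] b Hb; apply: coef_span_mulu.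
Qed.

Variables (S : bimodule A) (psi : 'I_2 -> S).
Variable Tp : forall n : nat, 'I_n.+1 -> 'I_2 -> 'I_n.+2 -> K.
Variable Tm : forall n : nat, 'I_n.+2 -> 'I_2 -> 'I_n.+1 -> K.
Hypothesis TPE : forall n, TP n = cgmx (@Tp n).
Hypothesis TME : forall n, TM n = cgmx (@Tm n).

Local Notation V := (fun i : nat * bool =>
  if i.2 then Vplus psi U Tp i.1 else Vminus psi U Tm i.1).

Lemma V0 i : V i 0.
Proof.
by case: i => [n []] /=; [|case: n => [//|n] /=]; apply: lin_span0.
Qed.

Lemma VD i x y : V i x -> V i y -> V i (x + y).
Proof.
case: i => [n []] /=; first exact: lin_spanD.
by case: n => [/= -> ->|n] /=; [rewrite addr0 | exact: lin_spanD].
Qed.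

Lemma VZ i c x : V i x -> V i (c%:A *> x).
Proof.
case: i => [n []] /=; first exact: lin_spanZ.
by case: n => [/= ->|n] /=; [rewrite lact0 | exact: lin_spanZ].
Qed.

Lemma V_left_span i x : V i x -> left_span psi x.
Proof.
have H n k (T : 'I_n.+1 -> 'I_2 -> 'I_k -> K) y :
    Vspan psi U T y -> left_span psi y.
  by move=> /Vspan_coord[a [ya _]]; exists a.
case: i => [n []] /=; first exact: H.
case: n => [/= ->|n] /=; last exact: H.
by exists (fun=> 0); rewrite big1 // => i _; rewrite lact0l.
Qed.

(** Row r, in the legs U n (x) K^2, of the component of the identity along T. *)
Lemma Vspan_mulmx n k (T : 'I_n.+1 -> 'I_2 -> 'I_k -> K) (L : 'M[K]_(k, n.+1 * 2)) r y :
  Vspan psi U T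
    (\sum_j (tens1 (U n) *m (cgmx T)%:S *m L%:S) (pr r j) y *> psi j).
Proof.
under eq_bigr do rewrite mxE lact_suml.
rewrite exchange_big; apply: lin_span_sum => b /=.
under eq_bigr do rewrite [X in _ * X]mxE mulr_algr lact_scaleA.
rewrite -lact_sum; apply: lin_spanZ.
have := lin_span_gen (fun rb : 'I_n.+1 * 'I_k =>
    \sum_s \sum_i (T s i rb.2 *: U n rb.1 s) *> psi i) (r, b).
congr (lin_span _ _); rewrite exchange_big; apply: eq_bigr => i _ /=.
rewrite mul_tens1E lact_suml; apply: eq_bigr => s _.
by rewrite mxE cgmxE mulr_algr.
Qed.

Lemma sum_of_coef n r s i : sum_of V (U n r s *> psi i).
Proof.
have -> : U n r s *> psi i = \sum_j tens1 (U n) (pr r j) (pr s i) *> psi j.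
  rewrite (bigD1 i) //= big1 => [|j ji]; first by rewrite tens1E eqxx addr0.
  by rewrite tens1E (negPf ji) lact0l.
case: n r s => [|n] r s.
  have [L [LT TL LP]] := U_split0 U_irr TPP TP0.
  have -> : tens1 (U 0) = tens1 (U 0) *m (cgmx (@Tp 0))%:S *m L%:S.
    by rewrite -TPE -mulmxA -map_mxM TL map_mx1 mulmx1.
  by apply: (sum_of_gen V0 (i := (0%N, true))); exact: Vspan_mulmx.
have [L1 [L2 [_ [TL L1P L2P]]]] := U_split U_irr TPP TMP TP0 TM0 n.
have -> : tens1 (U n.+1) = tens1 (U n.+1) *m (cgmx (@Tp n.+1))%:S *m L1%:S +
     tens1 (U n.+1) *m (cgmx (@Tm n))%:S *m L2%:S.
  rewrite -TPE -TME -!mulmxA -!map_mxM -mulmxDr -map_mxD TL.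
  by rewrite map_mx1 mulmx1.
under eq_bigr do rewrite mxE lactDl.
rewrite big_split; apply: (sum_ofD V0 VD).
  by apply: (sum_of_gen V0 (i := (n.+1, true))); exact: Vspan_mulmx.
by apply: (sum_of_gen V0 (i := (n.+1, false))); exact: Vspan_mulmx.
Qed.

Lemma left_span_sum_of x : left_span psi x <-> sum_of V x.
Proof.
split=> [[a ->]|[s [y [_ Vy ->]]]].
  apply: (sum_of_sum V0 VD) => i.
  apply: (coef_spanT (a i) (H := fun a => sum_of V (a *> psi i))).
  - by rewrite lact0l; exact: (sum_of0 V0).
  - by move=> b c; rewrite lactDl; apply: (sum_ofD V0 VD).
  - move=> c n r s; rewrite lact_scaleA.
    have [t [y [ut Vy ->]]] := sum_of_coef r s i.
    exists t, (fun i => c%:A *> y i); split=> // [j|].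
      exact: (VZ (i := j) c (Vy j)).
    by rewrite lact_sum.
have /choice[a aE] i : exists a : 'I_2 -> A, y i = \sum_j a j *> psi j.
  by have [a ->] := V_left_span (Vy i); exists a.
exists (fun j => \sum_(i <- s) a i j).
under eq_bigr do rewrite aE.
by rewrite exchange_big; apply: eq_bigr => j _; rewrite lact_suml.
Qed.
End Spanning.

(** * The eigenvalues as powers *)

Section Scalars.
Variables (K : fieldType) (p : K).
Hypotheses (p0 : p != 0) (p_free : forall n : nat, (0 < n)%N -> (p ^+ 2) ^+ n != 1).

Lemma qhat_neq0 : qhat p != 0.
Proof.
apply: contra (p_free (n := 2) isT); rewrite /qhat subr_eq0 => /eqP e.
by rewrite expr2 {2}e mulfV // expf_neq0.
Qed.

Lemma brack2_neq0 : brack2 p != 0.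
Proof.
apply: contra (p_free (n := 4) isT); rewrite /brack2 addr_eq0 => /eqP e.
have -> : (p ^+ 2) ^+ 4 = (p ^+ 2 * p ^+ 2) ^+ 2 by ring.
by rewrite {2}e mulrN mulfV ?expf_neq0 // sqrrN expr1n.
Qed.

Lemma sum_cap_cup : \sum_i \sum_j Cdn p i j * Cup p i j = - brack2 p.
Proof.
rewrite !sum2 !CupE !CdnE /quad /= /brack2; field. by [].
Qed.

Variable nu0 : K.
Hypothesis nu0_sign : nu0 = 1 \/ nu0 = -1.

Lemma sign_exp n : nu0 ^+ n = 1 \/ nu0 ^+ n = -1.
Proof.
case: nu0_sign => ->; first by left; rewrite expr1n.
by rewrite -signr_odd; case: (odd n); [right; rewrite expr1 | left; rewrite expr0].
Qed.

(** The ratio of the eigenvalue of X to its value x0 at 1, on V_n^+ for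
    i = (n, true) and on V_n^- for i = (n, false), when r = p^-1; for r = p the
    ratio is the inverse. *)
Definition twist (i : nat * bool) : K :=
  (nu0 * p ^- 2) ^ (if i.2 then i.1%:Z else - (i.1 + 2)%:Z).

Lemma nu0_neq0 : nu0 != 0.
Proof. by case: nu0_sign => ->; rewrite ?oppr_eq0 oner_neq0. Qed.

Lemma nu0V : nu0^-1 = nu0.
Proof. by case: nu0_sign => ->; rewrite ?invrN invr1. Qed.

(** Squaring removes the sign and leaves a power of q^-2. *)
Lemma twist_inj : injective twist.
Proof.
have b0 : nu0 * p ^- 2 != 0 by rewrite mulf_neq0 ?nu0_neq0 ?invr_neq0 ?expf_neq0.
have pos (k : nat) : (nu0 * p ^- 2) ^ k%:Z = 1 -> k = 0%N.
  case: k => // k e; have /eqP[] := p_free (n := (k.+1 * 2)%N) isT.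
  have : ((nu0 * p ^- 2) ^ k.+1%:Z) ^+ 2 = 1 by rewrite e expr1n.
  rewrite -exprnP exprAC (exprMn 2).
  have -> : nu0 ^+ 2 = 1 by case: nu0_sign => ->; rewrite ?sqrrN expr1n.
  rewrite mul1r !exprVn -(exprM (p ^+ 2)) (mulnC 2) => /(congr1 GRing.inv).
  by rewrite invrK invr1.
have zero (k : int) : (nu0 * p ^- 2) ^ k = 1 -> k = 0.
  case: k => k; first by move/pos->.
  move=> e; have /pos// : (nu0 * p ^- 2) ^ k.+1%:Z = 1.
  by apply: invr_inj; rewrite invr1 -exprnP; exact: e.
move=> [n b] [m d]; rewrite /twist /= => e.
have /zero : (nu0 * p ^- 2) ^ ((if b then n%:Z else - (n + 2)%:Z) -
    (if d then m%:Z else - (m + 2)%:Z)) = 1.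
  by rewrite expfzDr // -invr_expz -e mulfV // expfz_neq0.
by case: b d {e} => [] [] H; congr (_, _); lia.
Qed.

Lemma twistE i : twist i =
  nu0 ^+ i.1 * p ^ (- (if i.2 then 2 * i.1%:Z else - 4 - 2 * i.1%:Z)).
Proof.
have pX (k : int) : p ^ (2 * k) = (p ^+ 2) ^ k by rewrite -exprz_exp -exprnP.
case: i => n []; rewrite /twist /=.
  by rewrite -exprnP (exprMn n) -invr_expz pX exprVn -exprnP.
have -> : - (- 4 - 2 * n%:Z) = 2 * (n + 2)%:Z by lia.
rewrite pX -!invr_expz -!exprnP (exprMn (n + 2)) invfM exprVn invrK.
congr (_ * _); rewrite -exprVn nu0V exprD.
by case: nu0_sign => ->; rewrite ?sqrrN ?expr1n mulr1.
Qed.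

Lemma twist_plus n : (nu0 * p^-1 ^+ 2) ^+ n = twist (n, true).
Proof. by rewrite /twist /= exprVn. Qed.

Lemma twist_minus n :
  nu0 * (p^-1 + p * \sum_i \sum_j Cdn p i j * Cup p i j) ^+ 2
  / (nu0 * p^-1 ^+ 2) ^+ n = twist (n.+1, false).
Proof.
have -> : (p^-1 + p * \sum_i \sum_j Cdn p i j * Cup p i j) ^+ 2 = p ^+ 6.
  by rewrite sum_cap_cup /brack2; field.
rewrite twist_plus !twistE /= (exprS nu0 n).
have -> : - (- 4 - 2 * n.+1%:Z) = 6%:Z + 2 * n%:Z by lia.
rewrite expfzDr // -exprnP -invr_expz invfM invrK.
have -> : (nu0 ^+ n)^-1 = nu0 ^+ n by case: (sign_exp n) => ->; rewrite ?invrN invr1.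
ring.
Qed.

Lemma twist_plusV n : (nu0 * p ^+ 2) ^+ n = (twist (n, true))^-1.
Proof. by rewrite -twist_plus -exprVn invfM nu0V exprVn invrK. Qed.

Lemma twist_minusV n :
  nu0 * (p + p^-1 * \sum_i \sum_j Cdn p i j * Cup p i j) ^+ 2
  / (nu0 * p ^+ 2) ^+ n = (twist (n.+1, false))^-1.
Proof.
rewrite twist_plusV -twist_minus twist_plus !invfM nu0V; congr (_ * _ / _).
rewrite sum_cap_cup /brack2.
have -> : p + p^-1 * - (p ^+ 2 + p ^- 2) = - p ^- 3 by field.
have -> : p^-1 + p * - (p ^+ 2 + p ^- 2) = - p ^+ 3 by field.
by rewrite sqrrN invrN mulrNN -expr2 exprVn.
Qed.

(** The two factors of D^2 carry prefactors N p^(-a) p^-2 and its inverse up to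
    sign, which cancel. *)
Lemma eigenvalue_product (c1 gamma nu N : K) (eta eta' a : int) :
  qhat p != 0 -> N = 1 \/ N = -1 ->
  - brack2 p * c1 * ((p ^ (9 + a - 3 * eta) * N * gamma - 1) / qhat p)
    * ((p ^ (3 - a - 3 * eta') * N * nu * gamma - 1) / qhat p) =
  ((N * p ^ (- a))^-1 * (- brack2 p * c1 * p ^+ 2 / qhat p) -
     - brack2 p * c1 * (nu * gamma) * p ^ (5 - 3 * eta') / qhat p) *
  (N * p ^ (- a) * (p ^- 2 / qhat p) - gamma * p ^ (7 - 3 * eta) / qhat p).
Proof.
move=> qh0 N_sign.
have -> : 9 + a - 3 * eta = a + 2%:Z + (7 - 3 * eta) by lia.
have -> : 3 - a - 3 * eta' = - a - 2%:Z + (5 - 3 * eta') by lia.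
rewrite !(expfzDr _ _ p0) -!invr_expz -!exprnP.
move: (p ^ a) (expfz_neq0 a p0) => P P0.
move: (qhat p) qh0 (brack2 p) => h h0 b.
by case: N_sign => ->; field; rewrite h0 p0 P0 !expfz_neq0 // ?oppr_eq0 oner_neq0.
Qed.
End Scalars.

(** * The square of the Dirac operator *)

Section Main.
Variables (K : closedFieldType) (p c1 : K).
Hypotheses (p0 : p != 0) (p_free : forall n : nat, (0 < n)%N -> (p ^+ 2) ^+ n != 1).
Hypothesis c1_neq0 : c1 != 0.
Variables (nu0 gamma nu : K) (eta eta' : int).
Hypotheses (nu0_sign : nu0 = 1 \/ nu0 = -1).
Hypotheses (eta_sign : eta = 1 \/ eta = -1) (eta'_sign : eta' = 1 \/ eta' = -1).
Variables (A : algType K) (u : 'M[A]_2).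
Hypotheses (A_rel : SLq2_rel p u) (A_gen : generates (fun x => exists i j, x = u i j)).
Variable eps : A -> K.
Hypothesis epsL : forall (c : K) a b, eps (c *: a + b) = c * eps a + eps b.
Variables (Gam : bimodule A) (th : 'I_2 -> 'I_2 -> Gam).
Hypothesis Gam_4D : is_calculus4D p u th nu0.
Variables (GG : bimodule A) (tGG : Gam -> Gam -> GG).
Hypothesis GG_tensor : is_tensor tGG.
Variables (sigma : {additive GG -> GG}) (g : {additive GG -> A}).
Hypothesis sigma_braiding : is_braiding p th tGG sigma.
Hypothesis g_metric : is_metric p th tGG c1 g.
Variables (TG : algType K) (jA : {lrmorphism A -> TG}) (jG : {additive Gam -> TG}).
Variables (Cl : algType K) (pi : {lrmorphism TG -> Cl}).
Hypothesis Cl_clifford : is_clifford tGG sigma g jA jG pi.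
Variables (S0 : bimodule A) (emb : {additive S0 -> Cl}) (psip psim : 'I_2 -> S0).
Hypothesis S0_spinors : is_S0 p th (pi \o jA) (pi \o jG) c1 emb psip psim.
Variables (SG : bimodule A) (tSG : S0 -> Gam -> SG).
Hypothesis SG_tensor : is_tensor tSG.
Variables (GS : bimodule A) (tGS : Gam -> S0 -> GS).
Hypothesis GS_tensor : is_tensor tGS.
Variable tau : {additive SG -> GS}.
Hypothesis tauE : is_tau p th tSG tGS psip psim gamma nu eta eta' tau.
Variable mul : {additive GS -> S0}.
Hypothesis mulE : is_clifford_mul (pi \o jG) emb tGS mul.
Variable U : forall n : nat, 'M[A]_n.+1.
Hypothesis U_irr : forall n, irreducible (U n).
Hypothesis U_eps : forall n i j, eps (U n i j) = (i == j)%:R.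
Hypothesis U_1 : U 1%N = u.
Variable Tp : forall n : nat, 'I_n.+1 -> 'I_2 -> 'I_n.+2 -> K.
Hypothesis Tp_CG : forall n, is_CG u (U n) (U n.+1) (@Tp n).
Variable Tm : forall n : nat, 'I_n.+2 -> 'I_2 -> 'I_n.+1 -> K.
Hypothesis Tm_CG : forall n, is_CG u (U n.+1) (U n) (@Tm n).

Local Notation D := (dirac p th tSG tGS tau mul).
Local Notation Vp := (Vplus psip U Tp).
Local Notation Vm := (Vminus psip U Tm).
Local Notation V := (fun i : nat * bool => if i.2 then Vp i.1 else Vm i.1).
Local Notation kplus := (p ^- 2 / qhat p).
Local Notation kminus := (- brack2 p * c1 * p ^+ 2 / qhat p).
Local Notation tplus := (gamma * p ^ (7 - 3 * eta) / qhat p).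
Local Notation tminus := (- brack2 p * c1 * (nu * gamma) * p ^ (5 - 3 * eta') / qhat p).

Let TPP n : intertwines (U n.+1) (U n *t u) (cgmx (@Tp n)).
Proof. by have [] := CG_intertwines (Tp_CG n). Qed.
Let TMP n : intertwines (U n) (U n.+1 *t u) (cgmx (@Tm n)).
Proof. by have [] := CG_intertwines (Tm_CG n). Qed.
Let TP0 n : cgmx (@Tp n) != 0.
Proof. by have [] := CG_intertwines (Tp_CG n). Qed.
Let TM0 n : cgmx (@Tm n) != 0.
Proof. by have [] := CG_intertwines (Tm_CG n). Qed.
Let qh0 := qhat_neq0 p0 p_free.
Let b0 := brack2_neq0 p0 p_free.
Let delta0 : \sum_i \sum_j Cdn p i j * Cup p i j != 0.
Proof. by rewrite sum_cap_cup // oppr_eq0. Qed.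

Lemma U0_trivial : U 0 = 1%:M.
Proof. exact: (U0_eq1 (u_cup p0 A_rel) delta0 U_irr U_1 TPP TMP TP0 TM0). Qed.

(** D^2 on a common eigenvector of the operators Xp and Xm of the two halves, and
    the eigenvalues of both on each of the spaces V. *)
Lemma dirac_operators : exists Xp Xm : 'I_2 -> 'I_2 -> A -> A,
  [/\ forall i j (c : K) a b, Xp i j (c *: a + b) = c *: Xp i j a + Xp i j b,
      forall i j (c : K) a b, Xm i j (c *: a + b) = c *: Xm i j a + Xm i j b,
      forall a l l', eigenvector Xp a l -> eigenvector Xm a l' ->
        D (D (\sum_i a i *> psip i)) =
        ((l' - tminus) * (l - tplus))%:A *> \sum_i a i *> psip i &
      forall i x, V i x -> exists a, [/\ x = \sum_j a j *> psip j,
        eigenvector Xp a (twist p nu0 i * kplus) &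
        eigenvector Xm a ((twist p nu0 i)^-1 * kminus)]].
Proof.
have mulp := mul_psip p0 c1_neq0 b0 GG_tensor sigma_braiding g_metric Cl_clifford
  S0_spinors mulE.
have mulm := mul_psim p0 c1_neq0 b0 GG_tensor sigma_braiding g_metric Cl_clifford
  S0_spinors mulE.
have [Xp [XpL Xp1 XpM XpE]] :=
  theta_operator Gam_4D Cl_clifford S0_spinors GS_tensor mulE
    mulp (r := p^-1) (r' := p)
    (cplus_recursion p0) (theta_cplus p0).
have [Xm [XmL Xm1 XmM XmE]] :=
  theta_operator Gam_4D Cl_clifford S0_spinors GS_tensor mulE
    mulm (r := p) (r' := p^-1)
    (cminus_recursion c1 p0) (theta_cminus c1 p0).
pose ctp (m j k r s t l : 'I_2) := gamma * (p ^+ 2) ^+ (j.+1 + k.+1)%N *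
  Rhat p s t l k * Rpow p eta r l m j.
pose ctm (m j k r s t l : 'I_2) := nu * gamma * (p ^+ 2) ^+ (j.+1 + k.+1)%N *
  Rpow p eta' s t l k * Rinv p r l m j.
have tauP := tau_operator Cl_clifford S0_spinors GS_tensor mulE mulp SG_tensor
  (tau_lin tauE) (ct := ctp) (tau_psip tauE)
  (fun m z => tau_cplus p0 gamma m z eta_sign).
have tauM := tau_operator Cl_clifford S0_spinors GS_tensor mulE mulm SG_tensor
  (tau_lin tauE) (ct := ctm) (tau_psim tauE)
  (fun m z => tau_cminus c1 p0 (nu * gamma) m z eta'_sign).
have Dp a l : eigenvector Xp a l ->
    D (\sum_i a i *> psip i) = \sum_j ((l - tplus) *: a j) *> psim j.
  move=> aP; rewrite /dirac /nabla raddfB /= XpE tauP -sumrB.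
  by apply: eq_bigr => j _; rewrite aP scalerBl lactDl lactNl.
have Dm a l : eigenvector Xm a l ->
    D (\sum_i a i *> psim i) = \sum_j ((l - tminus) *: a j) *> psip j.
  move=> aP; rewrite /dirac /nabla raddfB /= XmE tauM -sumrB.
  by apply: eq_bigr => j _; rewrite aP scalerBl lactDl lactNl.
exists Xp, Xm; split=> //.
- move=> a l l' aP aM; rewrite (Dp a l aP).
  have aM' : eigenvector Xm (fun j => (l - tplus) *: a j) l'.
    move=> j; under eq_bigr do rewrite (XZ XmL).
    by rewrite -scaler_sumr aM !scalerA mulrC.
  rewrite (Dm _ _ aM') lact_sum; apply: eq_bigr => j _.
  by rewrite scalerA lact_scaleA.
have uc := u_cup p0 A_rel; have ud := u_cap p0 A_rel.
have pV0 : p^-1 != 0 by rewrite invr_eq0.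
have n0 := nu0_neq0 nu0_sign.
have plusP n : forall r b, eigenvector Xp (fun i => \sum_s Tp s i b *: U n r s)
    (twist p nu0 (n, true) * kplus).
  apply: (eigenvector_harmonic XpL); rewrite -twist_plus.
  exact: (plus_eig uc ud delta0 U_irr U_1 TPP TMP TP0 TM0 XpL Xp1 XpM).
have plusM n : forall r b, eigenvector Xm (fun i => \sum_s Tp s i b *: U n r s)
    ((twist p nu0 (n, true))^-1 * kminus).
  apply: (eigenvector_harmonic XmL); rewrite -twist_plusV //.
  exact: (plus_eig uc ud delta0 U_irr U_1 TPP TMP TP0 TM0 XmL Xm1 XmM).
have minusP n : forall r b, eigenvector Xp (fun i => \sum_s Tm s i b *: U n.+1 r s)
    (twist p nu0 (n.+1, false) * kplus).
  apply: (eigenvector_harmonic XpL); rewrite -twist_minus // mulrAC.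
  exact: (minus_eig uc ud delta0 U_irr U_1 TPP TMP TP0 TM0 XpL Xp1 XpM
    n0 pV0 epsL U_eps).
have minusM n : forall r b, eigenvector Xm (fun i => \sum_s Tm s i b *: U n.+1 r s)
    ((twist p nu0 (n.+1, false))^-1 * kminus).
  apply: (eigenvector_harmonic XmL); rewrite -twist_minusV // mulrAC.
  exact: (minus_eig uc ud delta0 U_irr U_1 TPP TMP TP0 TM0 XmL Xm1 XmM
    n0 p0 epsL U_eps).
case=> n [] x /=.
  by move/Vspan_coord=> [a [-> aP]]; exists a; split=> //; apply: aP.
case: n => [/= ->|n /= /Vspan_coord[a [-> aP]]]; last first.
  by exists a; split=> //; apply: aP.
exists (fun=> 0); split.
- by rewrite big1 // => j _; rewrite lact0l.
- by move=> j; rewrite scaler0 big1 // => i _; rewrite (X0 XpL).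
- by move=> j; rewrite scaler0 big1 // => i _; rewrite (X0 XmL).
Qed.

(** The spaces V lie in eigenspaces of Xp for distinct eigenvalues. *)
Lemma dirac_decomposition : is_direct_sum (left_span psip) V.
Proof.
have [Xp [Xm [XpL _ _ VP]]] := dirac_operators.
split; first exact: (left_span_sum_of A_gen U_irr TPP TMP TP0 TM0 U0_trivial).
move=> s y us Vy sum_y.
have /choice[a aP] i : exists a, y i = \sum_j a j *> psip j /\
    eigenvector Xp a (twist p nu0 i * kplus).
  by have [a [? ? _]] := VP i _ (Vy i); exists a.
have kp0 : kplus != 0 by rewrite mulf_neq0 ?invr_eq0 ?expf_neq0.
have tw_inj : injective (fun i => twist p nu0 i * kplus).
  by move=> i j /(mulIf kp0); apply: twist_inj.
have a0 j : \sum_(i <- s) a i j = 0.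
  have [F [_ FE]] := left_basis_coord (S0_basis S0_spinors).
  pose z (x : 'I_2 + 'I_2) : A := if x is inl j then \sum_(i <- s) a i j else 0.
  rewrite -[LHS]/(z (inl j)) -FE.
  have -> : \sum_x z x *> (match x with inl i => psip i | inr i => psim i end) = 0.
    rewrite big_sumType /= [X in _ + X]big1 ?addr0 => [|k _]; last exact: lact0l.
    rewrite -[RHS]sum_y; under [RHS]eq_bigr do rewrite (proj1 (aP _)).
    by rewrite exchange_big; apply: eq_bigr => k _; rewrite lact_suml.
  rewrite -(FE (fun=> 0) (inl j)); congr (F _ _).
  by rewrite big1 // => k _; rewrite lact0l.
move=> i is_; have [-> _] := aP i; rewrite big1 // => j _.
by rewrite (eigenvector_indep XpL us tw_inj (fun i => proj2 (aP i)) a0 is_) lact0l.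
Qed.

Lemma dirac_square_plus n x : Vp n x ->
  D (D x) = (eig_plus p nu0 c1 gamma nu eta eta' n)%:A *> x.
Proof.
have [Xp [Xm [_ _ DD VP]]] := dirac_operators.
move=> /(VP (n, true))[a [-> aP aM]]; rewrite (DD _ _ _ aP aM).
congr (_%:A *> _); rewrite twistE //= /eig_plus.
by rewrite (eigenvalue_product p0 _ _ _ _ _ _ qh0 (sign_exp nu0_sign n)).
Qed.

Lemma dirac_square_minus n x : (0 < n)%N -> Vm n x ->
  D (D x) = (eig_minus p nu0 c1 gamma nu eta eta' n)%:A *> x.
Proof.
have [Xp [Xm [_ _ DD VP]]] := dirac_operators.
move=> _ /(VP (n, false))[a [-> aP aM]]; rewrite (DD _ _ _ aP aM).
congr (_%:A *> _); rewrite twistE //= /eig_minus.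
rewrite -(eigenvalue_product p0 _ _ _ _ _ _ qh0 (sign_exp nu0_sign n)).
have -> : 9 + (- 4 - 2 * n%:Z) - 3 * eta = 5 - 2 * n%:Z - 3 * eta by lia.
by have -> : 3 - (- 4 - 2 * n%:Z) - 3 * eta' = 7 + 2 * n%:Z - 3 * eta' by lia.
Qed.
End Main.

Theorem mainTheorem13 (R : realType)
  (* the parameters q, q^(1/2) = p, and c_1 *)
  (q p c1 : R[i])
  (q_neq0 : q != 0)
  (q_not_root : forall n : nat, (0 < n)%N -> q ^+ n != 1)
  (q_real_or_unit : q \is Num.real \/ `|q| = 1)
  (p_sqrt : p ^+ 2 = q)
  (c1_real : c1 \is Num.real) (c1_neq0 : c1 != 0)
  (* the signs and the parameter of the connection *)
  (nu0 gamma nu : R[i]) (eta eta' : int)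
  (nu0_sign : nu0 = 1 \/ nu0 = -1)
  (nu_sign : nu = 1 \/ nu = -1)
  (eta_sign : eta = 1 \/ eta = -1)
  (eta'_sign : eta' = 1 \/ eta' = -1)
  (* the quantum group O(SL_q(2)) *)
  (A : algType R[i]) (u : 'M[A]_2) (A_SLq2 : is_SLq2 p u)
  (AA : algType R[i]) (tAA : A -> A -> AA)
  (Delta : {lrmorphism A -> AA}) (eps : {lrmorphism A -> R[i]^o})
  (A_coalg : is_SLq2_coalg u tAA Delta eps)
  (* the 4D calculus, its braiding and its metric *)
  (Gam : bimodule A) (th : 'I_2 -> 'I_2 -> Gam)
  (Gam_4D : is_calculus4D p u th nu0)
  (GG : bimodule A) (tGG : Gam -> Gam -> GG) (GG_tensor : is_tensor tGG)
  (sigma : {additive GG -> GG}) (sigma_braiding : is_braiding p th tGG sigma)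
  (g : {additive GG -> A}) (g_metric : is_metric p th tGG c1 g)
  (* the Clifford algebra, a quotient of the tensor algebra *)
  (TG : algType R[i]) (jA : {lrmorphism A -> TG}) (jG : {additive Gam -> TG})
  (Cl : algType R[i]) (pi : {lrmorphism TG -> Cl})
  (Cl_clifford : is_clifford tGG sigma g jA jG pi)
  (* the spinor bimodule S_0 *)
  (S0 : bimodule A) (emb : {additive S0 -> Cl}) (psip psim : 'I_2 -> S0)
  (S0_spinors : is_S0 p th (pi \o jA) (pi \o jG) c1 emb psip psim)
  (SG : bimodule A) (tSG : S0 -> Gam -> SG) (SG_tensor : is_tensor tSG)
  (GS : bimodule A) (tGS : Gam -> S0 -> GS) (GS_tensor : is_tensor tGS)
  (* tau and the Clifford multiplication, which define nabla and D *)
  (tau : {additive SG -> GS})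
  (tauE : is_tau p th tSG tGS psip psim gamma nu eta eta' tau)
  (mul : {additive GS -> S0})
  (mulE : is_clifford_mul (pi \o jG) emb tGS mul)
  (* the irreducible corepresentations and the Clebsch-Gordan matrices *)
  (U : forall n : nat, 'M[A]_n.+1)
  (U_irr : forall n, is_irr_corep tAA Delta eps (U n))
  (U_1 : U 1%N = u)
  (Tp : forall n : nat, 'I_n.+1 -> 'I_2 -> 'I_n.+2 -> R[i])
  (Tp_CG : forall n, is_CG u (U n) (U n.+1) (@Tp n))
  (Tm : forall n : nat, 'I_n.+2 -> 'I_2 -> 'I_n.+1 -> R[i])
  (Tm_CG : forall n, is_CG u (U n.+1) (U n) (@Tm n)) :
  let D := dirac p th tSG tGS tau mul in
  let Vp := Vplus psip U Tp in
  let Vm := Vminus psip U Tm in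
  is_direct_sum (left_span psip)
    (fun i : nat * bool => if i.2 then Vp i.1 else Vm i.1) /\
  (forall n x, Vp n x ->
     D (D x) = (eig_plus p nu0 c1 gamma nu eta eta' n)%:A *> x) /\
  (forall n x, (0 < n)%N -> Vm n x ->
     D (D x) = (eig_minus p nu0 c1 gamma nu eta eta' n)%:A *> x).
Proof.
have p0 : p != 0 by apply: contra_neq q_neq0 => p0; rewrite -p_sqrt p0 expr0n.
have p_free (n : nat) : (0 < n)%N -> (p ^+ 2) ^+ n != 1.
  by rewrite p_sqrt; exact: q_not_root.
have [A_rel A_gen _] := A_SLq2.
have irr n : irreducible (U n) by have [_ _] := U_irr n.
have epsL (c : R[i]) a b : eps (c *: a + b) = c * eps a + eps b.
  exact: (linearP eps).
have U_eps n i j : eps (U n i j) = (i == j)%:R.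
  by have [[_ H] _ _] := U_irr n; apply: H.
move=> D Vp Vm; split; last split.
- exact: (dirac_decomposition p0 p_free c1_neq0 nu0_sign eta_sign eta'_sign A_rel
    A_gen epsL Gam_4D GG_tensor sigma_braiding g_metric Cl_clifford S0_spinors
    SG_tensor GS_tensor tauE mulE irr U_eps U_1 Tp_CG Tm_CG).
- exact: (dirac_square_plus p0 p_free c1_neq0 nu0_sign eta_sign eta'_sign A_rel
    epsL Gam_4D GG_tensor sigma_braiding g_metric Cl_clifford S0_spinors
    SG_tensor GS_tensor tauE mulE irr U_eps U_1 Tp_CG Tm_CG).
- exact: (dirac_square_minus p0 p_free c1_neq0 nu0_sign eta_sign eta'_sign A_rel
    epsL Gam_4D GG_tensor sigma_braiding g_metric Cl_clifford S0_spinors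
    SG_tensor GS_tensor tauE mulE irr U_eps U_1 Tp_CG Tm_CG).
Qed.
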